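(* Let $n\geq 2$, let $A\in\mathbb{Z}^{m\times n}$ be an integral matrix of full column rank, let $b\in\mathbb{Z}^m$ and $c\in\mathbb{Q}^n$. Let $x^*$ be an optimal vertex of the linear program $\max\{c^\top x : Ax\le b,\ x\in\mathbb{R}^n\}$. If the integer program $\max\{c^\top x : Ax\le b,\ x\in\mathbb{Z}^n\}$ is feasible, then it has an optimal solution $z^*$ such that \[ \|x^*-z^*\|_\infty<\frac{4n+2}{9}\cdot\Delta_{n-1}(A). \]
   Context: For $k\in\{1,\dots,n\}$, $\Delta_k(A)$ denotes the maximum of $|\det M|$ over all $k\times k$ submatrices $M$ of $A$. *)

(* Defs.v *)
From HB Require Import structures.
From mathcomp Require Import all_boot all_order all_algebra.
From mathcomp Require Import reals.
Set Implicit Arguments. Unset Strict Implicit. Unset Printing Implicit Defensive.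
Import Order.TTheory GRing.Theory Num.Theory.
Local Open Scope ring_scope.

Definition mxR (R : realType) (m n : nat) (A : 'M[int]_(m, n)) : 'M[R]_(m, n) :=
  map_mx (fun a : int => a%:~R) A.

Definition lp_feasible (R : realType) (m n : nat) (A : 'M[int]_(m, n))
  (b : 'cV[int]_m) (x : 'cV[R]_n) : Prop :=
  forall i : 'I_m, (mxR R A *m x) i 0 <= (b i 0)%:~R.

Definition objR (R : realType) (n : nat) (c : 'cV[rat]_n) (x : 'cV[R]_n) : R :=
  \sum_(j < n) ratr (c j 0) * x j 0.

Definition lp_vertex (R : realType) (m n : nat) (A : 'M[int]_(m, n))
  (b : 'cV[int]_m) (x : 'cV[R]_n) : Prop :=
  lp_feasible A b x /\
  forall y z : 'cV[R]_n, lp_feasible A b y -> lp_feasible A b z ->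
    x = 2^-1 *: (y + z) -> y = z.

Definition lp_optimal (R : realType) (m n : nat) (A : 'M[int]_(m, n))
  (b : 'cV[int]_m) (c : 'cV[rat]_n) (x : 'cV[R]_n) : Prop :=
  lp_feasible A b x /\
  forall y : 'cV[R]_n, lp_feasible A b y -> objR c y <= objR c x.

Definition intvR (R : realType) (n : nat) (z : 'cV[int]_n) : 'cV[R]_n :=
  map_mx (fun a : int => a%:~R) z.

Definition ip_feasible (R : realType) (m n : nat) (A : 'M[int]_(m, n))
  (b : 'cV[int]_m) (z : 'cV[int]_n) : Prop :=
  lp_feasible A b (intvR R z).

Definition ip_optimal (R : realType) (m n : nat) (A : 'M[int]_(m, n))
  (b : 'cV[int]_m) (c : 'cV[rat]_n) (z : 'cV[int]_n) : Prop :=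
  ip_feasible R A b z /\
  forall w : 'cV[int]_n, ip_feasible R A b w ->
    objR c (intvR R w) <= objR c (intvR R z).

(* Delta_k(A): maximum of |det M| over k x k submatrices M of A
   (rows and columns chosen by injective index maps); 0 if none exists. *)
Definition Delta (m n k : nat) (A : 'M[int]_(m, n)) : nat :=
  \max_(f : {ffun 'I_k -> 'I_m} | injectiveb f)
    \max_(g : {ffun 'I_k -> 'I_n} | injectiveb g)
      `|\det (mxsub f g A)|%N.

Definition norm_inf (R : realType) (n : nat) (x : 'cV[R]_n) : R :=
  \big[Num.max/0]_(j < n) `|x j 0|.

(* Main.v *)
Require Import Defs.
From HB Require Import structures.
From mathcomp Require Import all_boot all_order all_algebra.
From mathcomp Require Import reals.
From mathcomp Require Import boolp ring lra zify.
Set Implicit Arguments. Unset Strict Implicit. Unset Printing Implicit Defensive.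
Import Order.TTheory GRing.Theory Num.Theory.
Local Open Scope ring_scope.

(** Let z be an optimal integer solution minimising the total slack of the rows tight at
    x*, and y = x* - z; flip the signs of rows so that A y >= 0.  Since A and b are
    integral, no nonzero integer p satisfies -1 < a_i p < a_i y + 1 for all i: otherwise
    z + p would be optimal with less slack.  Split y into vectors of the cone A x >= 0 lying
    in faces of dimension 2 or 3.  If w is such a vector in a d-dimensional face and alpha
    a coordinate functional, the translates of the prism [0, w] + U, where U is the set
    |a_i u| < 1/2 in the section alpha = 0 of the face, are disjoint modulo the integer
    lattice, whence alpha(w) vol(U) is at most 1.  The determinants of A bound vol(U) below
    by 1 / Delta for d = 2 and by 3 / (4 Delta) for d = 3, the latter because a symmetric
    polygon K with |det(p, q)| <= 1 for all p, q in K has a polar of area at least 3.  So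
    faces of dimension 2 and 3 contribute less than Delta and 4/3 Delta. *)

(** * Areas of dual polygons *)

(** The lattice of the volume argument comes from a frame: alpha on top of n - 1 rows of A. For
    alpha = e_k or -e_k its determinant is, up to sign, a minor of A of order n - 1, which is how
    Delta_(n-1) enters. For a vector w in a d-dimensional face, all but d - 1 of the chosen rows are
    tight at w, and among such frames one with the largest determinant is taken. By Cramer's rule,
    every row of A then has coordinates of absolute value at most 1 along the d - 1 free rows, and
    for d = 3 the 2 x 2 minors of these coordinates are at most 1 as well. This is the only
    information on the section U. No volume is measured: points are counted modulo the frame
    lattice, integer points for d = 2, and for d = 3 points of a grid so fine that the boundary
    losses cannot matter. For d = 2 and d = 3 the section is a segment or a polygon; such faces cost
    1/2 and 4/9 of Delta per dimension. Threes are therefore split off as long as possible, and a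
    remaining 4 is cut into 2 + 2; this gives the 4/9 and the 2/9 in the bound. *)

Section Primitive.
Variable R : realFieldType.
Implicit Types (f G : R -> R) (a b c I J u v : R).

(* A lower bound [I] for the area under [f] over [a, b], certified by a function [G]
   that telescopes against left Riemann sums; no integral is needed. *)
Definition primitive f a b I : Prop := exists G,
  [/\ G a = 0, G b = I & forall u v, a <= u -> u <= v -> v <= b ->
    0 <= G v - G u <= (v - u) * f u].

(** Monotonicity serves the intervals [u, v] that straddle b: the second certificate pays with
    [f b], which [f u] dominates. *)
Lemma primitive_cat f a b c I J :
  (forall u v, u <= v -> f v <= f u) -> a <= b -> b <= c ->
  primitive f a b I -> primitive f b c J -> primitive f a c (I + J).
Proof.
move=> fdec leab lebc [G [Ga Gb HG]] [H [Hb Hc HH]].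
exists (fun u => if u <= b then G u else I + H u); split.
- by rewrite leab.
- case: ifP => lecb; last by rewrite Hc.
  have -> : c = b by apply/eqP; rewrite eq_le lecb.
  by rewrite Gb -Hc (_ : c = b) ?Hb ?addr0 //; apply/eqP; rewrite eq_le lecb.
move=> u v leau leuv levc.
case: (leP u b) => leub; case: (leP v b) => levb.
- exact: HG.
- have /andP[h1 h2] := HG u b leau leub (lexx b).
  have /andP[h3 h4] := HH b v (lexx b) (ltW levb) levc.
  rewrite Gb in h1 h2; rewrite Hb in h3 h4.
  have h5 : (v - b) * f b <= (v - b) * f u.
    by apply: ler_wpM2l; [lra | exact: fdec].
  by apply/andP; split; nra.
- lra.
- have /andP[h1 h2] := HH u v (ltW leub) leuv levc.
  by apply/andP; split; lra.
Qed.

Lemma primitive_chord f a b va vb :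
  a <= b -> 0 <= vb <= va ->
  (forall t, 0 <= t -> t <= 1 -> (1 - t) * va + t * vb <= f ((1 - t) * a + t * b)) ->
  primitive f a b ((b - a) * (va + vb) / 2).
Proof.
move=> leab /andP[vb0 vba] fchord.
have [eab | ltab] := leP b a.
  have -> : b = a by apply/eqP; rewrite eq_le eab leab.
  exists (fun=> 0); split => //; first by rewrite subrr mul0r mul0r.
  move=> u v h1 h2 h3; have -> : v = u by apply/eqP; rewrite eq_le h2 (le_trans h3 h1).
  by rewrite !subrr mul0r lexx.
have ba0 : 0 < b - a by lra.
pose k := (va - vb) / (b - a).
have k0 : 0 <= k by rewrite divr_ge0 //; lra.
have kE : k * (b - a) = va - vb by rewrite mulfVK //; lra.
(* The exact area under the chord, of slope -k; the chord does not increase, so left Riemann sums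
   overestimate it. *)
exists (fun u => (u - a) * va - k * (u - a) ^+ 2 / 2); split.
- by rewrite subrr; ring.
- have -> : k * (b - a) ^+ 2 = (va - vb) * (b - a) by rewrite -kE; ring.
  by field.
move=> u v leau leuv levb.
have fu : va - k * (u - a) <= f u.
  have := fchord ((u - a) / (b - a)).
  rewrite divr_ge0 ?subr_ge0 //.
  rewrite ler_pdivrMr // mul1r => /(_ isT).
  have -> : u - a <= b - a by lra.
  move=> /(_ isT).
  have -> : (1 - (u - a) / (b - a)) * a + (u - a) / (b - a) * b = u.
    by field; lra.
  have -> // : (1 - (u - a) / (b - a)) * va + (u - a) / (b - a) * vb = va - k * (u - a).
  by rewrite /k; field; lra.
have kv : k * (v - a) <= va - vb by rewrite -kE; apply: ler_wpM2l => //; lra.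
have kuv : k * (u - a) <= k * (v - a) by apply: ler_wpM2l => //; lra.
have -> : (v - a) * va - k * (v - a) ^+ 2 / 2 - ((u - a) * va - k * (u - a) ^+ 2 / 2)
  = (v - u) * (va - (k * (u - a) + k * (v - a)) / 2) by field.
have vu : 0 <= v - u by lra.
by apply/andP; split; [apply: mulr_ge0 => //; lra | apply: ler_wpM2l => //; lra].
Qed.

Lemma primitive_point f a : primitive f a a 0.
Proof.
exists (fun=> 0); split => // u v h1 h2 h3.
have -> : v = u by apply/eqP; rewrite eq_le h2 (le_trans h3 h1).
by rewrite !subrr mul0r lexx.
Qed.

End Primitive.

Section Potential.
Variable R : realFieldType.
Implicit Types (x n p q : R * R) (a : R).

Definition dot x n := x.1 * n.1 + x.2 * n.2.
Definition in_box x := [&& 0 <= x.1, x.1 <= 1, 0 <= x.2 & x.2 <= 1].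

(* [x] runs along the boundary of a polygon in [0, 1]^2 and [n], with x . n = 1, along
   its dual; twice the two sector areas that remain until both reach (0, 1) amount to at
   least [potential x n]. *)
Definition potential x n :=
  let m := Num.max x.1 n.1 in (2 - x.2 - n.2) / m + m.

Lemma potentialC x n : potential x n = potential n x.
Proof. by rewrite /potential maxC addrAC. Qed.

(** The point x slides along the edge with normal n, and a = det(x, x') is twice the area of the
    sector swept. The proof distinguishes which of x.1, n.1 is the maximum before and after the
    move. *)
Lemma potential_move x n a :
  let x' := (x.1 - a * n.2, x.2 + a * n.1) in
  in_box x -> in_box n -> in_box x' -> dot x n = 1 -> 0 <= a ->
  potential x n <= potential x' n + a.
Proof.
case: x => x1 x2; case: n => n1 n2 /=.
rewrite /in_box /dot /potential /=.
move=> /and4P[x10 x11 x20 x21] /and4P[n10 n11 n20 n21] /and4P[y10 y11 y20 y21] xn a0.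
have [n1le|n1gt] := leP n1 0.
  have n1E : n1 = 0 by lra.
  have n2x2 : n2 * x2 = 1 by move: xn; rewrite n1E; lra.
  have n2E : n2 = 1 by nra.
  have x2E : x2 = 1 by nra.
  subst n1 n2 x2; rewrite !max_l //.
  have -> : 2 - 1 - 1 = 0 :> R by ring.
  have -> : 2 - (1 + a * 0) - 1 = 0 :> R by ring.
  by rewrite !mul0r; lra.
have yn : (x1 - a * n2) * n1 + (x2 + a * n1) * n2 = 1 by rewrite -xn; ring.
set y1 := x1 - a * n2 in y10 y11 yn *; set y2 := x2 + a * n1 in y20 y21 yn *.
(* With n1 as the maximum, the potential is affine in x and drops by exactly a. *)
have V1 : (2 - x2 - n2) / n1 + n1 = (2 - y2 - n2) / n1 + n1 + a.
  by rewrite /y2; field; lra.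
have yx : y1 <= x1 by rewrite /y1; nra.
have [x1n|nx1] := leP x1 n1.
  by rewrite !max_r ?V1 //; lra.
have [y1n|ny1] := leP y1 n1.
  rewrite -V1.
  (* As x . n = 1, the difference of the two sides is (1 - x2)(1 - n2). *)
  have S : n1 * x1 <= 2 - x2 - n2 by nra.
  have -> : (2 - x2 - n2) / n1 + n1 = (2 - x2 - n2) / x1 + x1 +
     ((2 - x2 - n2) - n1 * x1) * (x1 - n1) / (n1 * x1) by field; lra.
  rewrite lerDl divr_ge0 //; nra.
have h : 1 - n2 <= x1 * y1 by nra.
(* Here x . n = 1 turns the difference of the two sides into (1 - n2)(x1 y1 - (1 - n2)), and [h]
   applies. *)
have key : n1 * x1 <= (2 - x2 - n2) * n2 + x1 * y1 * (1 - n2) by nra.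
rewrite -subr_ge0.
have -> : (2 - y2 - n2) / y1 + y1 + a - ((2 - x2 - n2) / x1 + x1) =
   a * ((2 - x2 - n2) * n2 + x1 * y1 * (1 - n2) - n1 * x1) / (x1 * y1).
  have y1n0 : x1 - a * n2 != 0 by rewrite -/y1; lra.
  by rewrite /y2 /y1; field; apply/andP; split => //; lra.
by rewrite divr_ge0 ?mulr_ge0 //; lra.
Qed.

End Potential.

Section Area.
Variable R : realFieldType.
Implicit Types (x n p q : R * R) (a : R).

Lemma seq_argmin (T : eqType) (F : T -> R) (s : seq T) (x0 : T) :
  x0 \in s -> exists2 y, y \in s & forall z, z \in s -> F y <= F z.
Proof.
elim: s x0 => // y s IH x0 _.
case: s IH => [|z s] IH.
  by exists y; rewrite ?mem_head // => z; rewrite inE => /eqP->.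
have [w ws wmin] := IH z (mem_head z s).
have [le|lt] := leP (F y) (F w).
  exists y; rewrite ?mem_head // => v; rewrite inE => /predU1P[->//|vs].
  by apply: le_trans le (wmin _ vs).
exists w; first by rewrite inE ws orbT.
by move=> v; rewrite inE => /predU1P[->|vs]; [exact: ltW | exact: wmin].
Qed.

Lemma count_lt (T : eqType) (a1 a2 : pred T) (s : seq T) (y : T) :
  (forall z, z \in s -> a1 z -> a2 z) -> y \in s -> a2 y -> ~~ a1 y ->
  (count a1 s < count a2 s)%N.
Proof.
move=> sub ys a2y a1y.
have -> : count a1 s = count (predI a1 a2) s.
  by apply: eq_in_count => z zs /=; case: (a1 z) (sub z zs) => // /(_ isT) ->.
have -> : count a2 s = (count (predI a1 a2) s + count (predI (predC a1) a2) s)%N.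
  by elim: s {ys sub} => //= z s ->; case: (a1 z); case: (a2 z) => /=; lia.
by rewrite -addn1 leq_add2l -has_count; apply/hasP; exists y => //=; rewrite a1y.
Qed.

(** The graph of f is the upper boundary of the polar of P. In this form, every inequality on f is
    checked on the points of P. *)
Definition profile (P : seq (R * R)) (f : R -> R) := forall u v : R,
  (v <= f u) <-> (forall p, p \in P -> p.1 * u + p.2 * v <= 1).

Lemma profile_chord P f a b va vb : profile P f ->
  a <= b -> 0 <= vb <= va ->
  (forall p, p \in P -> p.1 * a + p.2 * va <= 1) ->
  (forall p, p \in P -> p.1 * b + p.2 * vb <= 1) ->
  primitive f a b ((b - a) * (va + vb) / 2).
Proof.
move=> fP ab vab Pa Pb; apply: primitive_chord => // t t0 t1.
by apply/fP => p pP; have := Pa p pP; have := Pb p pP; nra.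
Qed.

Lemma profile_noninc P f : profile P f -> all (@in_box R) P ->
  forall u v, u <= v -> f v <= f u.
Proof.
move=> fP /allP boxP u v uv; apply/fP => p pP.
have /fP/(_ p pP) := lexx (f v); have /and4P[p10 _ _ _] := boxP p pP; nra.
Qed.

Section Walk.
Variables (P Q : seq (R * R)) (f g : R -> R).
Hypotheses (fP : profile P f) (gQ : profile Q g).
Hypotheses (boxP : all (@in_box R) P) (boxQ : all (@in_box R) Q) (e2P : (0, 1) \in P).
(** This says that the points (p.2, p.1), for p in P, lie in the polar of Q. So P itself bounds the
    area under g from below while its polar gives the area under f, which ties the two areas to a
    dual pair of polygons. *)
Hypothesis PQ : forall p q, p \in P -> q \in Q -> p.1 * q.2 + q.1 * p.2 <= 1.

Let cross n q := n.1 * q.2 - n.2 * q.1.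

(* The term x.1 * x.2 - n.1 * n.2 turns sector areas into areas under the graphs.
   At x = n = (1, 0) the bound reads I + J >= 3 / 2. *)
Lemma dual_areas_ge k x n : (count (fun q => 0 < cross n q)%R P <= k)%N ->
  n = (1, 0) \/ n \in P -> in_box x -> (forall p, p \in P -> dot x p <= 1) ->
  dot x n = 1 -> exists I J, [/\ primitive f 0 x.1 I, primitive g n.2 1 J &
    potential x n + x.1 * x.2 - n.1 * n.2 <= 2 * (I + J)].
Proof.
elim: k x n => [|k IH] x n ck nP bx xT xn.
all: have bn : in_box n by case: nP => [->|/(allP boxP)//]; rewrite /in_box /=; lra.
all: have nQ q : q \in Q -> q.1 * n.2 + q.2 * n.1 <= 1.
1,3: move=> qQ; case: nP => [->|nP]; [
  by have /and4P[] := allP boxQ q qQ; rewrite /=; lra |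
  by have := PQ nP qQ; lra ].
all: case: x bx xT xn => x1 x2 bx xT xn; case: n nP ck bn nQ xn => n1 n2 nP ck bn nQ xn.
all: have := bx; have := bn; rewrite /in_box /dot /= in xn *.
all: move=> /and4P[n10 n11 n20 n21] /and4P[x10 x11 x20 x21].
all: have [n1le|n1gt] := leP n1 0.
1,3: have n1E : n1 = 0 by lra.
1,2: have n2x2 : n2 * x2 = 1 by move: xn; rewrite n1E; lra.
1,2: have n2E : n2 = 1 by nra.
1,2: have x2E : x2 = 1 by nra.
(* The end of the walk, n = (0, 1): a rectangle of height 1 remains under f. If x1 = 0 as well, the
   quotient in the potential is 0 / 0 = 0. *)
1,2: subst n1 n2 x2; exists x1, 0; split; [|exact: primitive_point|].
1,3: have -> : primitive f 0 x1 x1 = primitive f 0 x1 ((x1 - 0) * (1 + 1) / 2) by congr primitive; field.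
1,2: by apply: (profile_chord fP); try lra; move=> p pP; have := xT p pP; rewrite /dot /=; have /and4P[] := allP boxP p pP; lra.
1,2: rewrite /potential /= max_l // (_ : 2 - 1 - 1 = 0); [rewrite mul0r|]; lra.
  have : has (fun q => 0 < cross (n1, n2) q) P.
    by apply/hasP; exists (0, 1) => //; rewrite /cross /=; lra.
  by rewrite has_count; move: ck; rewrite leqn0 => /eqP ->.
pose s := [seq q <- P | 0 < cross (n1, n2) q].
have e2s : (0, 1) \in s by rewrite mem_filter e2P andbT /cross /=; lra.
(* Ratio test: q is the first constraint met when x slides along its edge, so y is the next vertex
   of the polar. The point (0, 1) of P guarantees that some constraint is met. *)
have [q] := @seq_argmin (R * R)%type (fun q => (1 - dot (x1, x2) q) / cross (n1, n2) q) _ _ e2s.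
rewrite mem_filter => /andP[b0 qP] qmin.
set b := cross _ _ in b0 qmin; pose a : R := (1 - dot (x1, x2) q) / b.
have a0 : 0 <= a by rewrite /a divr_ge0 ?(ltW b0) // subr_ge0; exact: xT.
have ab : a * b = 1 - dot (x1, x2) q by rewrite /a mulfVK // gt_eqF.
pose y1 := x1 - a * n2; pose y2 := x2 + a * n1.
have yE p : dot (y1, y2) p = dot (x1, x2) p + a * cross (n1, n2) p.
  by rewrite /dot /cross /y1 /y2 /=; ring.
have yT p : p \in P -> dot (y1, y2) p <= 1.
  move=> pP; rewrite yE; have [np|pp] := leP (cross (n1, n2) p) 0.
    by have := xT p pP; rewrite -[dot (x1,x2) p]/(x1 * p.1 + x2 * p.2); nra.
  have ps : p \in s by rewrite mem_filter pp.
  by have := qmin p ps; rewrite -/a ler_pdivlMr //; lra.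
have yn : y1 * n1 + y2 * n2 = 1 by rewrite -xn /y1 /y2 /=; ring.
have y21 : y2 <= 1 by have := yT _ e2P; rewrite /dot /=; lra.
have y2x : x2 <= y2 by rewrite /y2; nra.
have y1x : y1 <= x1 by rewrite /y1; nra.
have y10 : 0 <= y1.
  rewrite leNgt; apply/negP => y1n; have : y1 * n1 < 0 by nra.
  have : y2 * n2 <= 1 by nra.
  lra.
have bY : in_box (y1, y2) by rewrite /in_box /=; lra.
have qy : y1 * q.1 + y2 * q.2 = 1 by have := yE q; rewrite -/b ab /dot /=; lra.
have bq := allP boxP q qP; have := bq => /and4P[q10 q11 q20 q21].
(* Both n and q lie on the dual line y . = 1, so q is n moved by b along it: the same kind of move,
   with the roles of point and normal exchanged. *)
have q1E : q.1 = n1 - b * y2.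
  have -> : b * y2 = n1 * (q.2 * y2) - n2 * y2 * q.1 by rewrite /b /cross /=; ring.
  have -> : q.2 * y2 = 1 - y1 * q.1 by lra.
  have -> : n2 * y2 = 1 - y1 * n1 by lra.
  ring.
have q2E : q.2 = n2 + b * y1.
  have -> : b * y1 = y1 * n1 * q.2 - n2 * (y1 * q.1) by rewrite /b /cross /=; ring.
  have -> : y1 * q.1 = 1 - y2 * q.2 by lra.
  have -> : y1 * n1 = 1 - y2 * n2 by lra.
  ring.
(* Whatever lies beyond q lies beyond n, and q itself is no longer counted. *)
have ltk : (count (fun r => 0 < cross q r)%R P <= k)%N.
  rewrite -ltnS; apply: leq_trans ck.
  apply: (@count_lt _ _ _ _ q) => // [r rP qr|]; last first.
    by rewrite /cross mulrC subrr ltxx.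
  have /and4P[r10 _ _ _] := allP boxP r rP.
  have e : cross (n1, n2) r * q.1 = b * r.1 + cross q r * n1 by rewrite /b /cross /=; ring.
  have pos : 0 < cross (n1, n2) r * q.1.
    by rewrite e ltr_wpDl ?mulr_ge0 ?mulr_gt0 // ltW.
  have q1p : 0 < q.1.
    rewrite lt_neqAle q10 andbT eq_sym; apply/eqP => q0.
    by move: pos; rewrite q0 mulr0 ltxx.
  by rewrite -(pmulr_lgt0 _ q1p).
have [I [J [HI HJ HIJ]]] := IH (y1, y2) q ltk (or_intror qP) bY yT qy.
have m1 := @potential_move R (x1, x2) (n1, n2) a bx bn bY xn a0.
have m2 : potential (n1, n2) (y1, y2) <= potential q (y1, y2) + b.
  have := @potential_move R (n1, n2) (y1, y2) b bn bY; rewrite /= -q1E -q2E -surjective_pairing.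
  by apply => //; rewrite /dot /=; [lra | exact: ltW].
exists (I + (x1 - y1) * (y2 + x2) / 2), ((q.2 - n2) * (n1 + q.1) / 2 + J); split.
- apply: (primitive_cat (profile_noninc fP boxP) y10 y1x HI).
  apply: (profile_chord fP) => [||p pP|p pP]; [exact: y1x|by rewrite x20 y2x| |].
    by have := yT p pP; rewrite /dot /= [p.1 * _]mulrC [p.2 * _]mulrC.
  by have := xT p pP; rewrite /dot /= [p.1 * _]mulrC [p.2 * _]mulrC.
- apply: (@primitive_cat _ g n2 q.2 1) => //; first exact: profile_noninc gQ boxQ.
    by rewrite q2E lerDl mulr_ge0 // ltW.
  apply: (profile_chord gQ) => [|||r rQ].
  + by rewrite q2E lerDl mulr_ge0 // ltW.
  + by rewrite q10 q1E gerBl mulr_ge0 // ?(ltW b0) // (le_trans x20).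
  + exact: nQ.
  + by have := PQ qP rQ; rewrite addrC [q.1 * _]mulrC.
(* Twice the new trapezoids are a + x1 x2 - y1 y2 and b + q1 q2 - n1 n2, so the correction terms
   telescope. *)
- rewrite potentialC in m2; rewrite (potentialC q) in m2.
  move: m1 m2 HIJ => /=; rewrite -/y1 -/y2.
  have bE : b = n1 * q.2 - n2 * q.1 by [].
  have aE : a = x1 * y2 - x2 * y1 by rewrite /y1 /y2 -[LHS]mulr1 -xn /=; ring.
  by set V1 := potential _ _; set V2 := potential _ _; set V3 := potential _ _; lra.
Qed.

End Walk.
End Area.

(** * Grid points in a polygon *)

Section Count.
Variable R : realType.
Implicit Types (f g l : R -> R) (a b c h u v I J : R).

Definition ints a b : seq int :=
  [seq Num.floor a + 1 + i%:Z | i <-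
    iota 0 (if (Num.ceil b - 1 - Num.floor a)%R is Posz k then k else 0%N)].

Lemma ints_uniq a b : uniq (ints a b).
Proof. by rewrite map_inj_uniq ?iota_uniq // => i j /addrI[]. Qed.

Lemma ints_mem a b k : k \in ints a b -> a < k%:~R < b.
Proof.
case/mapP => i; rewrite mem_iota add0n.
case E : (Num.ceil b - 1 - Num.floor a) => [j|//] /andP[_ ilt] ->.
rewrite -floor_lt_int -ceil_gt_int.
move: E ilt; set p := Num.floor a; set q := Num.ceil b.
lia.
Qed.

Lemma ints_size a b : b - a - 1 <= (size (ints a b))%:R.
Proof.
rewrite size_map size_iota.
have h1 : (Num.floor a)%:~R <= a by exact: floor_le.
have h2 : b <= (Num.ceil b)%:~R by exact: ceil_ge.
have h3 : b - a - 1 <= (Num.ceil b - 1 - Num.floor a)%:~R.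
  by rewrite !intrB; lra.
case: (Num.ceil b - 1 - Num.floor a) h3 => [j|j] h3 //.
by apply: le_trans h3 _; rewrite NegzE mulrNz oppr_le0 ler0z.
Qed.

Lemma primitive_add f g a b I J : primitive f a b I -> primitive g a b J ->
  primitive (fun u => f u + g u) a b (I + J).
Proof.
move=> [F [Fa Fb HF]] [G [Ga Gb HG]]; exists (fun u => F u + G u); split.
- by rewrite Fa Ga addr0.
- by rewrite Fb Gb.
move=> u v h1 h2 h3; have /andP[f0 f1] := HF u v h1 h2 h3; have /andP[g0 g1] := HG u v h1 h2 h3.
by apply/andP; split; lra.
Qed.

(** The samples may start as late as h; since l is at most 2, the missing piece [0, u0] costs at
    most 2 h. The last cell is cut off at 1. *)
Lemma riemann_sum l I h u0 : primitive l 0 1 I ->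
  (forall u, 0 <= u -> l u <= 2) -> 0 < h -> 0 <= u0 <= h ->
  exists k : nat, [/\ forall j, (j < k)%N -> u0 + j%:R * h < 1, k%:R * h <= 1 + h &
    I - 2 * h <= h * \sum_(j < k) l (u0 + j%:R * h)].
Proof.
move=> [H [H0 H1 HH]] l2 h0 /andP[u00 u0h].
have l0 u : 0 <= u -> u < 1 -> 0 <= l u.
  move=> u0' u1; have /andP[h1 h2] := HH u 1 u0' (ltW u1) (lexx 1).
  by rewrite -(pmulr_rge0 _ (_ : 0 < 1 - u)) ?subr_gt0 // (le_trans h1).
have step p u : 0 <= u -> 1 - u <= p%:R * h ->
    exists k : nat, [/\ forall j, (j < k)%N -> u + j%:R * h < 1,
      k = 0%N \/ k%:R * h < 1 - u + h &
      H 1 - H (Num.min u 1) <= h * \sum_(j < k) l (u + j%:R * h)].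
  elim: p u => [|p IH] u u0' up.
    exists 0%N; split => //; first by left.
    by rewrite big_ord0 mulr0 min_r ?subrr //; lra.
  have [u1|u1] := leP 1 u.
    exists 0%N; split => //; first by left.
    by rewrite big_ord0 mulr0 subrr.
  have [||k [k1 k2 k3]] := IH (u + h); first lra.
    by move: up; rewrite -addn1 natrD; lra.
  have sh (j : nat) : u + j.+1%:R * h = u + h + j%:R * h by rewrite -addn1 natrD; ring.
  exists k.+1; split.
  - by case=> [_|j jk]; rewrite ?mul0r ?addr0 // sh; apply: k1.
  - by right; rewrite -addn1 natrD; case: k2 => [->|]; lra.
  rewrite big_ord_recl /= mul0r addr0 mulrDr.
  under eq_bigr => j _ do rewrite sh.
  set w := Num.min (u + h) 1 in k3.
  have uw : u <= w by rewrite le_min; lra.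
  have w1 : w <= 1 by rewrite ge_min lexx orbT.
  have wh : w - u <= h by rewrite lerBlDl ge_min lexx.
  have /andP[_ h2] := HH u w u0' uw w1.
  have h3 : (w - u) * l u <= h * l u by rewrite ler_wpM2r ?l0.
  by lra.
have [|k [k1 k2 k3]] := step (Num.Def.truncn ((1 - u0) / h)).+1 u0 u00.
  by rewrite -ler_pdivrMr // ltW // truncnS_gt.
exists k; split => //.
  by case: k2 => [->|]; lra.
apply: le_trans k3; set w := Num.min u0 1.
have w0 : 0 <= w by rewrite le_min u00 ler01.
have w1 : w <= 1 by rewrite ge_min lexx orbT.
have wh : w <= h by rewrite ge_min u0h.
have /andP[_] := HH 0 w (lexx 0) w0 w1; rewrite H0 subr0 subr0.
have : w * l 0 <= w * 2 by rewrite ler_wpM2l // l2.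
by rewrite H1; lra.
Qed.

(** Each column holds at least (lo + hi) / h - 1 grid points, and 1 / h + 1 bounds the number of
    columns. The labelling [kappa] allows the columns to be numbered to the right or to the left. *)
Lemma strip_count (lo hi : R -> R) I h u0 c (kappa : nat -> int) :
  injective kappa ->
  primitive (fun u => lo u + hi u) 0 1 I -> (forall u, 0 <= u -> lo u + hi u <= 2) ->
  0 < h -> 0 <= u0 <= h ->
  exists s : seq (int * int), [/\ uniq s,
    forall k, k \in s -> exists j : nat, let u := u0 + j%:R * h in
      [/\ k.1 = kappa j, u < 1 & - lo u < k.2%:~R * h - c < hi u] &
    (I - 2 * h) / h ^+ 2 - (1 / h + 1) <= (size s)%:R].
Proof.
move=> kinj HI l2 h0 u0h.
have [k [k1 k2 k3]] := riemann_sum HI l2 h0 u0h.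
pose u (j : nat) : R := u0 + j%:R * h.
pose S (j : nat) := ints ((c - lo (u j)) / h) ((c + hi (u j)) / h).
exists [seq (kappa j, z) | j <- iota 0 k, z <- S j]; split.
- apply: allpairs_uniq_dep; first exact: iota_uniq.
    by move=> j _; apply: ints_uniq.
  move=> [j z] [j' z'] _ _ /= [] /kinj -> -> //.
- move=> _ /allpairsPdep [j [z [jk zS ->]]]; exists j => /=.
  move: jk; rewrite mem_iota add0n => /andP[_ /k1 uj]; split => //.
  have := ints_mem zS; rewrite ltr_pdivrMr // ltr_pdivlMr // -/(u j) => /andP[a1 a2].
  by apply/andP; split; lra.
rewrite size_allpairs_dep sumnE big_map natr_sum.
have e : \sum_(j <- iota 0 k) ((lo (u j) + hi (u j)) / h - 1) =
    (\sum_(j < k) (lo (u j) + hi (u j))) / h - k%:R.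
  have -> : iota 0 k = index_iota 0 k by rewrite /index_iota subn0.
  rewrite big_mkord big_split /= -mulr_suml.
  by rewrite sumr_const card_ord mulNrn.
apply: le_trans (_ : \sum_(j <- iota 0 k) ((lo (u j) + hi (u j)) / h - 1) <= _); last first.
  apply: ler_sum => j _; apply: le_trans (ints_size _ _); rewrite lerD2r -mulrBl.
  by rewrite ler_pM2r ?invr_gt0 //; lra.
rewrite e; apply: lerB; last by rewrite -(ler_pM2r h0) mulrDl mul1r mulVf ?gt_eqF // mul1r.
rewrite expr2 invfM mulrA ler_pM2r ?invr_gt0 // ler_pdivrMr // [leRHS]mulrC.
exact: k3.
Qed.

Lemma profile_exists (P : seq (R * R)) : P != [::] -> (forall p, p \in P -> 0 < p.2) ->
  exists f, profile P f.
Proof.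
elim: P => // p P IH _ pos.
have p2 : 0 < p.2 by apply: pos; rewrite mem_head.
have one u v : (v <= (1 - p.1 * u) / p.2) = (p.1 * u + p.2 * v <= 1).
  by rewrite ler_pdivlMr // lerBrDl [v * _]mulrC.
case: P IH pos => [|q P] IH pos.
  exists (fun u => (1 - p.1 * u) / p.2) => u v; rewrite one; split => [h r|h].
    by rewrite inE => /eqP->.
  by apply: h; rewrite mem_head.
have [//|r rP|f fP] := IH; first by apply: pos; rewrite inE rP orbT.
exists (fun u => Num.min ((1 - p.1 * u) / p.2) (f u)) => u v; rewrite le_min one.
split => [/andP[h1 /fP h2] r|h].
  by rewrite inE => /predU1P[->//|/h2].
rewrite h ?mem_head //=; apply/fP => r rP; apply: h; by rewrite inE rP orbT.
Qed.

Lemma addz_neq_subz (z : int) (i j : nat) : z + i%:Z <> z - 1 - j%:Z.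
Proof. lia. Qed.

(** Doubling all lengths turns 1/2 into 1 and the mesh into h = 2 / N. The polar of the rows then
    has area at least 3, and 3 / h^2 is the leading term. The halves to the right and left of the
    centre are counted separately and exchanged by the point reflection. *)
Lemma grid_points_in_polygon (rows : seq (R * R)) :
  (forall r, r \in rows -> `|r.1| <= 1 /\ `|r.2| <= 1) ->
  (forall r r', r \in rows -> r' \in rows -> `|r.1 * r'.2 - r'.1 * r.2| <= 1) ->
  forall (N : nat) (c1 c2 : R), (0 < N)%N -> exists s : seq (int * int), [/\ uniq s,
    forall k, k \in s -> forall r, r \in rows ->
      `|r.1 * (k.1%:~R / N%:R - c1) + r.2 * (k.2%:~R / N%:R - c2)| < 2^-1 &
    3 / 4 * N%:R ^+ 2 - 3 * N%:R - 2 <= (size s)%:R :> R].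
Proof.
move=> unit dets N c1 c2 N0.
pose rows2 := rows ++ [seq (- r.1, - r.2) | r <- rows].
have unit2 r : r \in rows2 -> `|r.1| <= 1 /\ `|r.2| <= 1.
  rewrite mem_cat => /orP[/unit//|/mapP[q /unit[h1 h2] ->]] /=; by rewrite !normrN.
have dets2 r r' : r \in rows2 -> r' \in rows2 -> `|r.1 * r'.2 - r'.1 * r.2| <= 1.
  rewrite !mem_cat => /orP[hr|/mapP[q hr ->]] /orP[hr'|/mapP[q' hr' ->]] /=.
  - exact: dets.
  - by rewrite -normrN (le_trans _ (dets _ _ hr hr')) // le_eqVlt; apply/orP; left; apply/eqP; congr `|_|; ring.
  - by rewrite -normrN (le_trans _ (dets _ _ hr hr')) // le_eqVlt; apply/orP; left; apply/eqP; congr `|_|; ring.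
  - by rewrite !mulrNN; apply: dets.
(* Rows in the upper right quadrant bound f; those in the upper left one, reflected, bound g. Adding
   (0, 1) is harmless: its determinant with a row is a coordinate, at most 1 in absolute value. *)
pose P := (0, 1) :: [seq r <- rows2 | (0 <= r.1) && (0 < r.2)].
pose Q := (0, 1) :: [seq (- r.1, r.2) | r <- [seq r <- rows2 | (r.1 <= 0) && (0 < r.2)]].
have PP p : p \in P -> [/\ 0 <= p.1, 0 < p.2, p.1 <= 1 & p.2 <= 1].
  rewrite inE => /predU1P[->/=|]; first by split; lra.
  by rewrite mem_filter => /andP[/andP[h1 h2] /unit2[h3 h4]]; move: h3 h4; rewrite !ler_norml => /andP[_ ?] /andP[_ ?].
have QQ p : p \in Q -> [/\ 0 <= p.1, 0 < p.2, p.1 <= 1 & p.2 <= 1].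
  rewrite inE => /predU1P[->/=|]; first by split; lra.
  case/mapP => r; rewrite mem_filter => /andP[/andP[h1 h2] /unit2[h3 h4]] -> /=.
  by move: h3 h4; rewrite !ler_norml => /andP[? ?] /andP[? ?]; split; lra.
have [//|p /PP[]//|f fP] := @profile_exists P.
have [//|p /QQ[]//|g gQ] := @profile_exists Q.
have boxP : all (@in_box R) P.
  by apply/allP => p /PP[h1 h2 h3 h4]; rewrite /in_box h1 h3 (ltW h2) h4.
have boxQ : all (@in_box R) Q.
  by apply/allP => p /QQ[h1 h2 h3 h4]; rewrite /in_box h1 h3 (ltW h2) h4.
have PQ p q : p \in P -> q \in Q -> p.1 * q.2 + q.1 * p.2 <= 1.
  move=> pP qQ; have [p0 p1 p2 p3] := PP p pP; have [q0 q1 q2 q3] := QQ q qQ.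
  move: pP qQ; rewrite inE => /predU1P[->/= _|pP]; first by lra.
  rewrite inE => /predU1P[->/=|qQ]; first by lra.
  case/mapP: qQ => r; rewrite mem_filter => /andP[_ rr] ->.
  move: pP; rewrite mem_filter => /andP[_ pr] /=.
  by have := dets2 p r pr rr; rewrite ler_norml => /andP[_]; lra.
have e1T p : p \in P -> dot (1, 0) p <= 1 by move=> /PP[]; rewrite /dot /=; lra.
have [I [J [HI HJ]]] := @dual_areas_ge R P Q f g fP gQ boxP boxQ (mem_head _ _) PQ _ (1, 0) (1, 0)
  (leqnn _) (or_introl (erefl _)) ltac:(rewrite /in_box /=; lra) e1T ltac:(rewrite /dot /=; lra).
rewrite /potential /= maxxx => HIJ.
have IJ : 3 / 2 <= I + J by move: HIJ; rewrite divr1; lra.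
have f1 u : f u <= 1.
  by have /fP/(_ (0, 1) (mem_head _ _)) := lexx (f u); rewrite /=; lra.
have g1 u : g u <= 1.
  by have /gQ/(_ (0, 1) (mem_head _ _)) := lexx (g u); rewrite /=; lra.
have slice0 u v r : 0 <= u -> u < 1 -> - g u < v < f u -> r \in rows2 -> 0 <= r.2 ->
    `|r.1 * u + r.2 * v| < 1.
  move=> u0 u1 /andP[v1 v2] rr r20; have [] := unit2 r rr.
  rewrite !ler_norml => /andP[a1 a2] /andP[a3 a4].
  rewrite ltr_norml; have := f1 u; have := g1 u => gu fu.
  have [r2|r2] := leP r.2 0.
    have -> : r.2 = 0 by lra.
    by rewrite mul0r addr0; apply/andP; split; nra.
  have [r1|r1] := leP 0 r.1.
    have rP : r \in P by rewrite inE mem_filter r1 r2 rr orbT.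
    have /fP/(_ r rP) := lexx (f u) => b1.
    by apply/andP; split; nra.
  have rQ : (- r.1, r.2) \in Q.
    by rewrite inE; apply/orP; right; apply/mapP; exists r => //; rewrite mem_filter (ltW r1) r2.
  have /gQ/(_ _ rQ) := lexx (g u) => /= b1.
  by apply/andP; split; nra.
have slice u v r : 0 <= u -> u < 1 -> - g u < v < f u -> r \in rows ->
    `|r.1 * u + r.2 * v| < 1.
  move=> u0 u1 uv rr; have [r2|r2] := leP 0 r.2.
    by apply: slice0 => //; rewrite mem_cat rr.
  have -> : r.1 * u + r.2 * v = - ((- r.1) * u + (- r.2) * v) by ring.
  rewrite normrN; apply: (slice0 u v (- r.1, - r.2)) => //=; last by rewrite oppr_ge0 ltW.
  by rewrite mem_cat; apply/orP; right; apply/mapP; exists r.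
pose h : R := 2 / N%:R; have NR : 0 < N%:R :> R by rewrite ltr0n.
have h0 : 0 < h by rewrite divr_gt0.
have hN : h * N%:R = 2 by rewrite mulfVK // gt_eqF.
(* The first grid column at or to the right of the centre, at distance u0; the left half starts one
   column earlier, at distance h - u0. *)
pose k0 := Num.ceil (N%:R * c1); pose u0 : R := k0%:~R * h - 2 * c1.
have cE : 2 * c1 = N%:R * c1 * h by rewrite -hN; ring.
have u0h : 0 <= u0 < h.
  have /andP[z1 z2] := ceil_itv (N%:R * c1); rewrite -/k0 intrB in z1 z2.
  by rewrite /u0 cE; apply/andP; split; nra.
have /andP[u00 u0lt] := u0h.
have kE (k : int) (c : R) : k%:~R * h - 2 * c = 2 * (k%:~R / N%:R - c).
  by rewrite /h; field; rewrite gt_eqF.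
have [s1 [us1 s1P s1s]] := @strip_count g f (J + I) h u0 (2 * c2) (fun j => k0 + j%:Z)
  ltac:(by move=> i j /addrI[]) (primitive_add HJ HI) ltac:(by move=> u _; have := f1 u; have := g1 u; lra)
  h0 ltac:(lra).
have [s2 [us2 s2P s2s]] := @strip_count f g (I + J) h (h - u0) (2 * c2) (fun j => k0 - 1 - j%:Z)
  ltac:(by move=> i j /addrI/oppr_inj[]) (primitive_add HI HJ) ltac:(by move=> u _; have := f1 u; have := g1 u; lra)
  h0 ltac:(lra).
exists (s1 ++ s2); split.
- rewrite cat_uniq us1 us2 andbT /=; apply/hasPn => k /s2P[j [e2 _ _]]; apply/negP => /s1P[i [e1 _ _]].
  by move: e2; rewrite e1; apply: addz_neq_subz.
- move=> k; rewrite mem_cat => /orP[/s1P|/s2P] [j [e ju uv]] r rr.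
    have ue : k.1%:~R * h - 2 * c1 = u0 + j%:R * h by rewrite e /u0 intrD; ring.
    have u_ge0 : 0 <= u0 + j%:R * h by rewrite addr_ge0 // mulr_ge0 ?ler0n // ltW.
    have := slice _ _ r u_ge0 ju uv rr; rewrite -ue !kE.
    have -> : r.1 * (2 * (k.1%:~R / N%:R - c1)) + r.2 * (2 * (k.2%:~R / N%:R - c2)) =
      2 * (r.1 * (k.1%:~R / N%:R - c1) + r.2 * (k.2%:~R / N%:R - c2)) by ring.
    by rewrite normrM ger0_norm // -ltr_pdivlMl // mulr1.
  have ue : - (k.1%:~R * h - 2 * c1) = h - u0 + j%:R * h.
    by rewrite e /u0 !intrB; ring.
  have u_ge0 : 0 <= h - u0 + j%:R * h.
    by rewrite addr_ge0 ?subr_ge0 ?(ltW u0lt) // mulr_ge0 ?ler0n // ltW.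
  have := slice _ (- (k.2%:~R * h - 2 * c2)) r u_ge0 ju; rewrite ltrN2 ltrNl andbC => /(_ uv rr).
  rewrite -ue !kE.
  have -> : r.1 * - (2 * (k.1%:~R / N%:R - c1)) + r.2 * - (2 * (k.2%:~R / N%:R - c2)) =
    - (2 * (r.1 * (k.1%:~R / N%:R - c1) + r.2 * (k.2%:~R / N%:R - c2))) by ring.
  by rewrite normrN normrM ger0_norm // -ltr_pdivlMl // mulr1.
rewrite size_cat natrD.
(* Each half holds at least (I + J) N^2 / 4 - N - (N / 2 + 1) points. *)
have hV : 1 / h = N%:R / 2 by rewrite /h; field; rewrite gt_eqF.
have E (K : R) : (K - 2 * h) / h ^+ 2 = K * N%:R ^+ 2 / 4 - N%:R.
  by rewrite /h; field; rewrite gt_eqF.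
rewrite E hV in s1s; rewrite E hV in s2s.
have K : 3 / 2 * N%:R ^+ 2 <= (I + J) * N%:R ^+ 2 by rewrite ler_wpM2r // exprn_ge0 // ltW.
by move: s1s s2s K; clear; set X := (size s1)%:R; set Y := (size s2)%:R; set Z := N%:R ^+ 2; lra.
Qed.

End Count.

(** * Lattice classes *)

Lemma absz_det_unit n (L : 'M[int]_n) : L \in unitmx -> `|\det L|%N = 1%N.
Proof. by rewrite unitmxE unitrE => /eqP/(congr1 absz); rewrite abszM; case: (\det L) => k; lia. Qed.

(* The classes of Z^n modulo M Z^n are counted by |det M|, via the Smith form. *)
Lemma lattice_pigeonhole n (M : 'M[int]_n) (s : seq 'cV[int]_n) :
  \det M != 0 -> uniq s -> (`|\det M| < size s)%N ->
  exists v w, [/\ v \in s, w \in s, v != w & exists p, v - w = M *m p].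
Proof.
move=> detM us lts.
have [L uL [S uS [d _ defM]]] := int_Smith_normal_form M.
pose D : 'M[int]_n := diag_mx (\row_i d`_i).
have DE : (\matrix_(i, j) (d`_i *+ (i == j :> nat))) = D.
  by apply/matrixP => i j; rewrite !mxE.
rewrite DE in defM.
pose e (i : 'I_n) : int := d`_i.
have detE : `|\det M|%N = (\prod_(i < n) `|e i|)%N.
  rewrite defM !det_mulmx !abszM (absz_det_unit uL) (absz_det_unit uS) mul1n muln1 det_diag.
  under eq_bigr do rewrite mxE.
  by rewrite -(big_morph absz abszM (erefl : `|1|%N = 1%N)).
have dn0 (i : 'I_n) : e i != 0.
  apply/negP => /eqP di; move/negP: detM; apply.
  by rewrite -absz_eq0 detE (bigD1 i) //= di mul0n.
(* The residues of L^-1 v modulo the diagonal of the Smith form; the shape [.-1.+1] of the bound is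
   what [inord] requires. *)
pose cls (v : 'cV[int]_n) : {dffun forall i : 'I_n, 'I_(`|e i|.-1.+1)} :=
  [ffun i => inord (`|((invmx L *m v) i 0%R %% e i)%Z|)].
have clsP v w (i : 'I_n) : cls v = cls w ->
    (e i %| (invmx L *m v) i 0%R - (invmx L *m w) i 0%R)%Z.
  move=> /ffunP/(_ i); rewrite !ffunE => /(congr1 val) /=.
  have di := dn0 i.
  have lt (u : int) : (`|(u %% e i)%Z| < `|e i|.-1.+1)%N.
    by have := modz_ge0 u di; have := ltz_mod u di; lia.
  rewrite !inordK //.
  have := modz_ge0 ((invmx L *m v) i 0) di; have := modz_ge0 ((invmx L *m w) i 0) di.
  move=> h1 h2 h3; rewrite -eqz_mod_dvd; apply/eqP; lia.
have : ~~ uniq (map cls s).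
  apply/negP => ucs.
  have := max_card (mem (map cls s)); rewrite (card_uniqP ucs) size_map.
  rewrite card_dep_ffun foldrE big_map big_enum /=.
  under eq_bigr do rewrite card_ord prednK ?absz_gt0 ?dn0 //.
  by rewrite -detE leqNgt lts.
move=> /(uniqPn (cls 0)) [i [j [ij]]]; rewrite size_map => js.
rewrite !(nth_map 0) //; last exact: ltn_trans ij js.
set v := nth 0 s i; set w := nth 0 s j => vw.
have il := ltn_trans ij js.
exists v, w; split; rewrite ?mem_nth //.
  by rewrite nth_uniq // neq_ltn ij.
pose q := \col_(i < n) (((invmx L *m v) i 0%R - (invmx L *m w) i 0%R) %/ e i)%Z.
exists (invmx S *m q).
rewrite defM -!mulmxA mulKVmx //.
have -> : D *m q = invmx L *m (v - w).
  rewrite mulmxBr; apply/colP => k; rewrite mul_diag_mx !mxE mulrC -/(e k).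
  by have := clsP v w k vw; rewrite !mxE => h; rewrite divzK.
by rewrite mulKVmx.
Qed.

(** * Splitting a vector of a polyhedral cone *)

Section RowRank.
Variables (F : fieldType) (m n : nat) (A : 'M[F]_(m, n)).
Implicit Types (S T : {set 'I_m}) (x : 'cV[F]_n).

Definition rowval i x : F := (A *m x) i 0.

Lemma rowvalD i x x' : rowval i (x + x') = rowval i x + rowval i x'.
Proof. by rewrite /rowval mulmxDr mxE. Qed.
Lemma rowvalZ i a x : rowval i (a *: x) = a * rowval i x.
Proof. by rewrite /rowval -scalemxAr mxE. Qed.
Lemma rowvalN i x : rowval i (- x) = - rowval i x.
Proof. by rewrite /rowval mulmxN mxE. Qed.
Lemma rowval0 i : rowval i 0 = 0.
Proof. by rewrite /rowval mulmx0 mxE. Qed.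
Lemma rowvalB i x x' : rowval i (x - x') = rowval i x - rowval i x'.
Proof. by rewrite rowvalD rowvalN. Qed.
Lemma rowvalE i x : rowval i x = (A *m x) i 0.
Proof. by []. Qed.
Lemma row_mul_rowval i x : row i A *m x = (rowval i x)%:M.
Proof. by rewrite -row_mul; apply/matrixP => j k; rewrite !ord1 mxE [RHS]mxE eqxx mulr1n. Qed.

(** Rows outside S are zeroed rather than deleted, so that all these matrices have the same
    shape. *)
Definition rows_in S : 'M[F]_(m, n) := \matrix_(i, j) (A i j *+ (i \in S)).
Definition rows_rank S := \rank (rows_in S).

Lemma row_rows_in S i : row i (rows_in S) = if i \in S then row i A else 0.
Proof.
by apply/rowP => j; rewrite !mxE; case: (i \in S); rewrite !mxE ?mulr1n ?mulr0n.
Qed.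

Lemma rows_in_mul0 S x :
  reflect (forall i, i \in S -> rowval i x = 0) (rows_in S *m x == 0).
Proof.
apply: (iffP eqP) => [e i iS|h].
  have := congr1 (row i) e; rewrite row_mul row_rows_in iS row_mul_rowval row0.
  by move/matrixP/(_ 0 0); rewrite !mxE eqxx mulr1n.
apply/row_matrixP => i; rewrite row_mul row_rows_in row0.
case: ifP => iS; last by rewrite mul0mx.
by rewrite row_mul_rowval h // raddf0.
Qed.

Lemma rows_in_sub S T : S \subset T -> (rows_in S <= rows_in T)%MS.
Proof.
move=> ST; apply/row_subP => i; rewrite row_rows_in; case: ifP => iS; last exact: sub0mx.
by have := row_sub i (rows_in T); rewrite row_rows_in (subsetP ST i iS).
Qed.

Lemma rows_rank_mono S T : S \subset T -> (rows_rank S <= rows_rank T)%N.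
Proof. by move=> ST; apply: mxrankS; apply: rows_in_sub. Qed.

(** Submodularity: the span of the common rows lies in the intersection of the two spans. *)
Lemma rows_rankU S T : (rows_rank (S :|: T) + rows_rank (S :&: T) <= rows_rank S + rows_rank T)%N.
Proof.
rewrite /rows_rank -[leqRHS]mxrank_sum_cap; apply: leq_add; apply: mxrankS.
  apply/row_subP => i; rewrite row_rows_in inE.
  case: ifP => [/orP[iS|iT]|_]; last exact: sub0mx.
    apply: submx_trans (addsmxSl _ _).
    by have := row_sub i (rows_in S); rewrite row_rows_in iS.
  apply: submx_trans (addsmxSr _ _).
  by have := row_sub i (rows_in T); rewrite row_rows_in iT.
by rewrite sub_capmx !rows_in_sub ?subsetIl ?subsetIr.
Qed.

Lemma rows_rank_lt S T i x : S \subset T -> i \in T -> (forall j, j \in S -> rowval j x = 0) ->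
  rowval i x != 0 -> (rows_rank S < rows_rank T)%N.
Proof.
move=> ST iT Sx ix; apply: rank_ltmx; rewrite ltmxE rows_in_sub //=.
apply/negP => /(submx_trans (row_sub i _)); rewrite row_rows_in iT.
case/submxP => u e; move/negP: ix; apply.
have := row_mul_rowval i x; rewrite e -mulmxA (eqP (introT (rows_in_mul0 S x) Sx)) mulmx0.
by move/matrixP/(_ 0 0); rewrite [in RHS]mxE eqxx mulr1n mxE => <-.
Qed.

Lemma rows_rank_le S : (rows_rank S <= n)%N.
Proof. exact: rank_leq_col. Qed.

Lemma rows_rank_full S x : rows_rank S = n -> (forall i, i \in S -> rowval i x = 0) -> x = 0.
Proof.
move=> rS Sx; have /row_fullP[B BS] : row_full (rows_in S) by apply/eqP.
by rewrite -[x]mul1mx -BS -mulmxA (eqP (introT (rows_in_mul0 S x) Sx)) mulmx0.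
Qed.

Lemma ker_exists p (B : 'M[F]_(p, n)) : (\rank B < n)%N ->
  exists2 x : 'cV[F]_n, x != 0 & B *m x = 0.
Proof.
move=> rB; have : cokermx B != 0 by rewrite -mxrank_eq0 mxrank_coker; lia.
rewrite -trmx_eq0 -nz_row_eq0 => nz; exists (nz_row (cokermx B)^T)^T; first by rewrite trmx_eq0.
have /submxP[u ->] := nz_row_sub (cokermx B)^T.
by rewrite trmx_mul trmxK mulmxA mulmx_coker mul0mx.
Qed.

End RowRank.

Section Cone.
Variables (R : realFieldType) (m n : nat) (A : 'M[R]_(m, n)).
Local Notation rowval := (rowval A).
Local Notation rows_rank := (rows_rank A).
Implicit Types (x y d e : 'cV[R]_n).

Definition in_cone x := forall i, 0 <= rowval i x.
Definition tight x : {set 'I_m} := [set i | rowval i x == 0].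

Lemma exists_min_ratio (T : finType) (P : pred T) (r : T -> R) i0 : P i0 ->
  exists2 i, P i & forall j, P j -> r i <= r j.
Proof. by move=> Pi0; case: (arg_minP r Pi0) => i Pi h; exists i. Qed.

(* Among the directions of the cone {s_i l_i >= 0 : i in S} increasing h, one
   of maximal tight rank is an extreme ray. *)
Lemma extreme_direction (S : {set 'I_m}) (s : 'I_m -> R) (h : 'rV[R]_n) d :
  rows_rank S = n -> (forall i, i \in S -> s i != 0) ->
  (forall i, i \in S -> 0 <= s i * rowval i d) -> 0 < (h *m d) 0 0 ->
  exists d', [/\ forall i, i \in S -> 0 <= s i * rowval i d', 0 < (h *m d') 0 0 &
    (n.-1 <= rows_rank (S :&: tight d'))%N /\ S :&: tight d \subset S :&: tight d'].
Proof.
move=> rS s0; have [k] := ubnP (n - rows_rank (S :&: tight d)).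
elim: k d => // k IH d; rewrite ltnS => ck Sd hd.
have [?|lt] := leqP n.-1 (rows_rank (S :&: tight d)); first by exists d; rewrite subxx.
set Z := S :&: tight d in ck lt.
(* As the rank is below n - 1, some nonzero direction keeps both the tight rows and the value of h;
   following it until a further row becomes tight raises the rank. *)
have [e0 e0n] : exists2 e : 'cV[R]_n, e != 0 & col_mx (rows_in A Z) h *m e = 0.
  apply: (@ker_exists _ _ _ (col_mx (rows_in A Z) h)).
  have : (\rank (col_mx (rows_in A Z) h) <= rows_rank Z + 1)%N.
    rewrite -addsmxE; apply: leq_trans (mxrank_adds_leqif _ _) _.
    by rewrite leq_add2l rank_leq_row.
  lia.
rewrite mul_col_mx => /eqP; rewrite col_mx_eq0 => /andP[/rows_in_mul0 Ze0 /eqP he0].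
have [i1 i1S i1e] : exists2 i, i \in S & rowval i e0 != 0.
  apply/exists_inP; apply: contraNT e0n => /exists_inPn no.
  by apply/eqP; apply: (rows_rank_full rS) => i iS; apply/eqP; have := no i iS; rewrite negbK.
have [e [he Ze [i2 i2S i2e]]] : exists e, [/\ (h *m e) 0 0 = 0,
    (forall i, i \in Z -> rowval i e = 0) & exists2 i, i \in S & s i * rowval i e < 0].
  have ne : s i1 * rowval i1 e0 != 0 by rewrite mulf_neq0 // s0.
  case: (ltgtP (s i1 * rowval i1 e0) 0) ne => // [lt0|gt0] _.
    by exists e0; split => //; [rewrite he0 mxE | exists i1].
  exists (- e0); split.
  - by rewrite mulmxN he0 !mxE oppr0.
  - by move=> i iZ; rewrite rowvalN Ze0 // oppr0.
  - by exists i1 => //; rewrite rowvalN mulrN oppr_lt0.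
have [i /andP[iS ie] imin] := @exists_min_ratio _ [pred i | (i \in S) && (s i * rowval i e < 0)]
  (fun i => s i * rowval i d / - (s i * rowval i e)) i2 (introT andP (conj i2S i2e)).
pose t := s i * rowval i d / - (s i * rowval i e).
have ie' : 0 < - (s i * rowval i e) by rewrite oppr_gt0.
have t0 : 0 <= t by rewrite divr_ge0 ?Sd // ltW.
have ti : s i * rowval i (d + t *: e) = 0.
  have tE : t * - (s i * rowval i e) = s i * rowval i d by rewrite mulfVK // gt_eqF.
  by rewrite rowvalD rowvalZ mulrDr -tE; ring.
have Zsub : Z \subset S :&: tight (d + t *: e).
  apply/subsetP => j jZ; rewrite in_setI inE rowvalD rowvalZ Ze // mulr0 addr0.
  by move: jZ; rewrite in_setI inE.
case: (IH (d + t *: e)).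
- apply: leq_trans ck; apply: ltn_sub2l; first exact: leq_trans lt (leq_pred n).
  apply: (@rows_rank_lt _ _ _ A _ _ i e) => //.
  + rewrite in_setI iS inE /=; move/eqP: ti; rewrite mulf_eq0 => /orP[/eqP e0'|//].
    by have := s0 i iS; rewrite e0' eqxx.
  + by apply/eqP => ie0; rewrite ie0 mulr0 ltxx in ie.
- move=> j jS; rewrite rowvalD rowvalZ mulrDr.
  have [je|je] := ltP (s j * rowval j e) 0; last first.
    by rewrite addr_ge0 ?Sd // mulrCA mulr_ge0.
  have := imin j; rewrite /= jS je -/t => /(_ isT).
  rewrite ler_pdivlMr ?oppr_gt0 // => q.
  have -> : s j * (t * rowval j e) = t * (s j * rowval j e) by ring.
  by lra.
- by rewrite mulmxDr -scalemxAr mxE [X in _ + X]mxE he mulr0 addr0.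
move=> d' [Sd' hd' [rd' sub]]; exists d'; split => //; split => //.
exact: subset_trans Zsub sub.
Qed.

Hypothesis rankA : \rank A = n.

Lemma rowval_inj x : (forall i, rowval i x = 0) -> x = 0.
Proof.
move=> h; apply: (@rows_rank_full _ _ _ A setT) => [|i _]; last exact: h.
rewrite /rows_rank (_ : rows_in A setT = A) //.
by apply/matrixP => i j; rewrite mxE inE mulr1n.
Qed.

End Cone.

Section Vertices.
Variables (R : realFieldType) (m n : nat) (A : 'M[R]_(m, n)).
Hypothesis rankA : \rank A = n.
Local Notation rowval := (rowval A).
Local Notation rows_rank := (rows_rank A).
Local Notation tight := (tight A).
Local Notation in_cone := (in_cone A).
Implicit Types (x y d e : 'cV[R]_n).

Definition between y x := in_cone x /\ in_cone (y - x).
Definition is_vertex y x := between y x /\ rows_rank (tight x :|: tight (y - x)) = n.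

Lemma vertex_uniq y x x' : is_vertex y x ->
  tight x = tight x' -> tight (y - x) = tight (y - x') -> x = x'.
Proof.
move=> [_ rx] e1 e2; apply/eqP; rewrite -subr_eq0; apply/eqP; apply: (rows_rank_full rx) => i.
rewrite in_setU => /orP[ix|ix]; rewrite rowvalB.
  by have := ix; rewrite e1; move: ix; rewrite !inE => /eqP-> /eqP->; rewrite subrr.
have := ix; rewrite e2; move: ix; rewrite !inE !rowvalB => /eqP e3 /eqP e4; lra.
Qed.

(** The sum of all rows is positive on the cone away from 0, because A has full column rank; it
    measures progress towards y. *)
Let h : 'rV[R]_n := const_mx 1 *m A.

Lemma h_rowval x : (h *m x) 0 0 = \sum_i rowval i x.
Proof. by rewrite /h -mulmxA mxE; apply: eq_bigr => i _; rewrite mxE mul1r. Qed.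

Lemma h_gt0 x : in_cone x -> x != 0 -> 0 < (h *m x) 0 0.
Proof.
move=> Cx x0; rewrite h_rowval lt_neqAle sumr_ge0 // andbT eq_sym.
apply: contraNneq x0 => /eqP; rewrite psumr_eq0 // => /allP al.
by apply/eqP/(rowval_inj rankA) => i; apply/eqP; apply: al; rewrite mem_index_enum.
Qed.

Lemma improving_vertex y x : is_vertex y x -> x != y ->
  exists x' (Z : {set 'I_m}), [/\ is_vertex y x', (h *m x) 0 0 < (h *m x') 0 0,
    (n.-1 <= rows_rank Z)%N, tight y \subset Z /\ Z \subset tight x :|: tight (y - x) &
    Z :&: tight x \subset tight x' /\ Z :&: tight (y - x) \subset tight (y - x')].
Proof.
move=> [[Cx Cyx] rx] xy.
(* With these signs the direction y - x is admissible. A row tight on both sides vanishes at y; [yZ]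
   will show that d vanishes on it too. *)
pose s i : R := if i \in tight x then 1 else -1.
have s0 i : i \in tight x :|: tight (y - x) -> s i != 0.
  by move=> _; rewrite /s; case: ifP => _; rewrite ?oppr_eq0 oner_eq0.
have S0 i : i \in tight x :|: tight (y - x) -> 0 <= s i * rowval i (y - x).
  rewrite in_setU /s; case: ifP => [_ _|_ /=]; first by rewrite mul1r.
  by rewrite inE => /eqP->; rewrite mulr0.
have h0 : 0 < (h *m (y - x)) 0 0 by apply: h_gt0 => //; rewrite subr_eq0 eq_sym.
have [d []] := extreme_direction rx s0 S0 h0.
set Z := _ :&: tight d => Sd hd [rZ sub].
have yZ : tight y \subset Z.
  apply: subset_trans sub; apply/subsetP => i; rewrite !inE => /eqP iy.
  by have := Cx i; have := Cyx i; rewrite !rowvalB iy => h1 h2; apply/andP; split; [apply/orP; left|]; apply/eqP; lra.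
have dneg i : rowval i d < 0 -> 0 < rowval i x.
  move=> id; rewrite lt_neqAle Cx andbT eq_sym; apply/negP => ix.
  have it : i \in tight x by rewrite inE.
  by have := Sd i; rewrite in_setU it /s it mul1r => /(_ isT); rewrite leNgt id.
have dpos i : 0 < rowval i d -> 0 < rowval i (y - x).
  move=> id; rewrite lt_neqAle Cyx andbT eq_sym; apply/negP => ix.
  have it : i \in tight (y - x) by rewrite inE.
  have := Sd i; rewrite in_setU it orbT /s => /(_ isT).
  case: ifP => [ix0 _|_]; last by rewrite mulN1r oppr_ge0 leNgt id.
  have : i \in tight y.
    by move: ix0 ix; rewrite !inE rowvalB => /eqP-> /eqP; rewrite subr0 => ->.
  by move/(subsetP yZ); rewrite in_setI => /andP[_]; rewrite inE => /eqP i0; rewrite i0 ltxx in id.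
have [i0 i0d] : exists i, rowval i d != 0.
  apply/existsP; apply: contraLR hd => /existsPn no; rewrite -leNgt h_rowval big1 // => i _.
  by apply/eqP; have := no i; rewrite negbK.
(* The time at which row i reaches its lower bound 0 or its upper bound, its value at y, when moving
   along d. *)
pose r i := if rowval i d < 0 then rowval i x / - rowval i d else rowval i (y - x) / rowval i d.
have [i id imin] := @exists_min_ratio _ _ [pred i | rowval i d != 0] r i0 i0d.
pose t := r i; have t0 : 0 < t.
  rewrite /t /r; have [lt|ge] := ltP (rowval i d) 0.
    by rewrite divr_gt0 ?oppr_gt0 ?dneg.
  have gt : 0 < rowval i d by rewrite lt_def ge andbT.
  by rewrite divr_gt0 ?dpos.
have yx' : y - (x + t *: d) = (y - x) - t *: d by rewrite opprD addrA.
have blk : (i \in tight (x + t *: d)) || (i \in tight (y - (x + t *: d))).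
  rewrite !inE yx' rowvalD [rowval i (y - x - _)]rowvalB !rowvalZ /t /r.
  have [lt|ge] := ltP (rowval i d) 0; apply/orP; [left|right].
    by rewrite invrN mulrN mulNr mulfVK ?subrr // lt_eqF.
  by rewrite mulfVK ?subrr.
have Zlo : Z :&: tight x \subset tight (x + t *: d).
  apply/subsetP => j; rewrite in_setI in_setI [j \in tight d]inE => /andP[/andP[_ /eqP jd]].
  by rewrite !inE rowvalD rowvalZ jd mulr0 addr0.
have Zup : Z :&: tight (y - x) \subset tight (y - (x + t *: d)).
  apply/subsetP => j; rewrite in_setI in_setI [j \in tight d]inE => /andP[/andP[_ /eqP jd]].
  by rewrite !inE yx' [rowval j (y - x - _)]rowvalB rowvalZ jd mulr0 subr0.
exists (x + t *: d), Z; split => //; first split; first split.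
- move=> j; rewrite rowvalD rowvalZ; have [jd|jd] := ltP (rowval j d) 0; last first.
    by rewrite addr_ge0 // mulr_ge0 // ltW.
  have := imin j; rewrite /= lt_eqF // => /(_ isT); rewrite -/t {1}/r jd ler_pdivlMr ?oppr_gt0 //.
  by rewrite mulrN -subr_ge0 opprK.
- move=> j; rewrite yx' rowvalB rowvalZ subr_ge0; have [jd|jd] := leP (rowval j d) 0.
    by apply: le_trans (Cyx j); rewrite mulr_ge0_le0 // ltW.
  have := imin j; rewrite /= gt_eqF // => /(_ isT); rewrite -/t {1}/r ltNge (ltW jd) /=.
  by rewrite ler_pdivlMr.
- apply/eqP; rewrite eqn_leq rows_rank_le /=.
  have : (rows_rank Z < rows_rank (tight (x + t *: d) :|: tight (y - (x + t *: d))))%N.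
    apply: (@rows_rank_lt _ _ _ A _ _ i d) => //.
    + apply/subsetP => j jZ; have : j \in tight x :|: tight (y - x).
        by move: jZ; rewrite in_setI => /andP[].
      rewrite !in_setU => /orP[jx|jx]; apply/orP; [left|right].
        by apply: (subsetP Zlo); rewrite in_setI jZ.
      by apply: (subsetP Zup); rewrite in_setI jZ.
    + by rewrite in_setU.
    + by move=> j; rewrite in_setI [j \in tight d]inE => /andP[_ /eqP].
  by move=> lt; apply: leq_trans (leqSpred n) (leq_ltn_trans rZ lt).
- by rewrite mulmxDr -scalemxAr [ltRHS]mxE [X in _ + X]mxE ltrDl mulr_gt0.
- by split => //; exact: subsetIl.
Qed.

(* Walk along improving edges of {x | 0 <= A x <= A y} from 0 to y until the rank of
   [tight (y - x)] reaches [n - (D - k)]. The last edge has tight rows of rank [n - 1], and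
   those of y - x contribute less than [n - (D - k)], so [tight x] still has large rank. *)
Lemma split_cone y (D k : nat) : in_cone y -> (n <= D + rows_rank (tight y))%N -> (k <= D)%N ->
  exists x, [/\ in_cone x, in_cone (y - x), (n <= k + rows_rank (tight x))%N &
    (n <= (D - k) + rows_rank (tight (y - x)))%N].
Proof.
move=> Cy Dy kD; pose K := (n - (D - k))%N.
have [Kr|rK] := leqP K (rows_rank (tight y)).
  exists 0; split.
  - by move=> i; rewrite rowval0.
  - by rewrite subr0.
  - rewrite (_ : tight 0 = setT); last by apply/setP => i; rewrite !inE rowval0 eqxx.
    have : rows_rank setT = n by rewrite /rows_rank (_ : rows_in A setT = A) //; apply/matrixP => i j; rewrite mxE inE mulr1n.
    by move=> ->; exact: leq_addl.
  - by rewrite subr0; rewrite /K in Kr; lia.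
(* A vertex is determined by its two tight sets, so a maximum over finitely many pairs yields the
   vertex with the largest h whose [tight (y - x)] is still below rank K. Its improving neighbour
   must reach K. *)
pose Good (u : {set 'I_m} * {set 'I_m}) x :=
  [/\ is_vertex y x, (rows_rank (tight (y - x)) < K)%N & u = (tight x, tight (y - x))].
have [x0 vx0 x0K] : exists2 x, is_vertex y x & (rows_rank (tight (y - x)) < K)%N.
  exists 0; last by rewrite subr0.
  split; first by split => [i|]; rewrite ?rowval0 ?subr0.
  apply/eqP; rewrite eqn_leq rows_rank_le /=.
  have e : rows_rank setT = n by rewrite /rows_rank (_ : rows_in A setT = A) //; apply/matrixP => i j; rewrite mxE inE mulr1n.
  rewrite -[leqLHS]e; apply: rows_rank_mono; apply/subsetP => i _; rewrite !inE rowval0 eqxx //.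
have [X XP] : exists X : {set 'I_m} * {set 'I_m} -> 'cV[R]_n,
    forall u, (exists x, Good u x) -> Good u (X u).
  have : forall u, exists x, (exists x, Good u x) -> Good u x.
    by move=> u; have [[x Gx]|no] := pselect (exists x, Good u x); [exists x | exists 0].
  by move=> /boolp.choice[X XP]; exists X.
pose Pu u := `[< exists x, Good u x >].
have Pu0 : Pu (tight x0, tight (y - x0)) by apply/asboolP; exists x0.
case: (arg_maxP (fun u => (h *m X u) 0 0) Pu0) => u /asboolP Pu1 umax.
have [vx xK uE] := XP u Pu1; set x := X u in vx xK uE umax.
have xy : x != y.
  apply: contraTneq xK => ->; rewrite subrr -leqNgt.
  rewrite (_ : tight 0 = setT); last by apply/setP => i; rewrite !inE rowval0 eqxx.
  have : rows_rank setT = n by rewrite /rows_rank (_ : rows_in A setT = A) //; apply/matrixP => i j; rewrite mxE inE mulr1n.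
  by move=> ->; rewrite /K leq_subr.
have [x' [Z [vx' hx rZ [yZ Zsub] [Zlo Zup]]]] := improving_vertex vx xy.
exists x'; have [[Cx' Cyx'] _] := vx'.
have Kx' : (K <= rows_rank (tight (y - x')))%N.
  rewrite leqNgt; apply/negP => ltK.
  pose u' := (tight x', tight (y - x')).
  have Pu' : exists x, Good u' x by exists x'.
  have [vX _ [e1 e2]] := XP u' Pu'.
  have xE : x' = X u' by apply: vertex_uniq vx' e1 e2.
  by have := umax u' (asboolT Pu'); rewrite -xE /= => /(lt_le_trans hx); rewrite ltxx.
split => //; last by rewrite /K in Kx'; lia.
(* By submodularity, [Z :&: tight x] has rank at least (n - 1) + (n - D) - (K - 1) = n - k, and
   these rows stay tight at x'. *)
have : (rows_rank Z + rows_rank (tight y) <= rows_rank (Z :&: tight x) + rows_rank (Z :&: tight (y - x)))%N.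
  have ZE : Z = (Z :&: tight x) :|: (Z :&: tight (y - x)).
    by rewrite -setIUr; apply/esym/setIidPl.
  rewrite {1}ZE.
  apply: leq_trans (rows_rankU _ _ _); rewrite leq_add2l; apply: rows_rank_mono.
  apply/subsetP => i iy; rewrite !in_setI (subsetP yZ i iy) /=.
  have [[Cx Cyx] _] := vx; have := Cx i; have := Cyx i; move: iy.
  by rewrite !inE !rowvalB => /eqP-> h1 h2; apply/andP; split; apply/eqP; lra.
have := rows_rank_mono A Zlo.
have : (rows_rank (Z :&: tight (y - x)) <= rows_rank (tight (y - x)))%N by apply: rows_rank_mono; apply: subsetIr.
rewrite /K in xK rK; lia.
Qed.

End Vertices.

(** * Vectors in faces of dimension two and three *)

Section Frame.
Variables (R : realFieldType) (m n : nat) (A : 'M[int]_(m, n.+1)) (alpha : 'rV[int]_n.+1).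
Local Notation toR := (map_mx (fun a : int => a%:~R : R)).
Local Notation AR := (toR A).
Local Notation rowval := (rowval AR).
Local Notation tight := (tight AR).
Hypothesis rankA : \rank AR = n.+1.

Definition frame (f : {ffun 'I_n -> 'I_m}) : 'M[int]_(n.+1) := col_mx alpha (rowsub f A).
Definition obj (w : 'cV[R]_n.+1) : R := (toR alpha *m w) 0 0.

Lemma det_toR p (M : 'M[int]_p) : \det (toR M) = (\det M)%:~R.
Proof. by rewrite (det_map_mx intr). Qed.

Lemma frameEd f (j : 'I_n) k : frame f (rshift 1 j) k = A (f j) k.
Proof. by have := col_mxEd alpha (rowsub f A) j k; rewrite [in RHS]mxE. Qed.

Lemma frameEu f k : frame f (lshift n (ord0 : 'I_1)) k = alpha 0 k.
Proof. exact: (col_mxEu alpha (rowsub f A)). Qed.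

Lemma frame_mul f (w : 'cV[R]_n.+1) :
  toR (frame f) *m w = col_mx (toR alpha *m w) (rowsub f (AR *m w)).
Proof.
rewrite -mul_rowsub_mx -mul_col_mx; congr (_ *m _).
rewrite -[LHS]/(toR (col_mx alpha (rowsub f A))) map_col_mx.
by have -> : toR (rowsub f A) = rowsub f AR by apply/matrixP => i j; rewrite !mxE.
Qed.

Lemma frame_mulEd f (x : 'cV[R]_n.+1) (j : 'I_n) :
  (toR (frame f) *m x) (rshift 1 j) 0 = rowval (f j) x.
Proof.
rewrite frame_mul.
by have := col_mxEd (toR alpha *m x) (rowsub f (AR *m x)) j 0; rewrite [in RHS]mxE.
Qed.

Lemma frame_mulEu f (x : 'cV[R]_n.+1) : (toR (frame f) *m x) ord0 0 = obj x.
Proof.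
rewrite frame_mul; have -> : ord0 = lshift n (ord0 : 'I_1) by apply: val_inj.
exact: (col_mxEu (toR alpha *m x) (rowsub f (AR *m x))).
Qed.

(** The functional alpha is independent of the tight rows, since these vanish at w and alpha does
    not. A basis of the tight rows is completed by rows of A independent on the common kernel. Only
    d - 1 free positions occur, because alpha accounts for one dimension. *)
Lemma select_rows d (w : 'cV[R]_n.+1) :
  (0 < d)%N -> (n.+1 <= d + rows_rank AR (tight w))%N -> obj w != 0 ->
  exists2 f : {ffun 'I_n -> 'I_m}, (forall j : 'I_n, (d.-1 <= j)%N -> f j \in tight w) & \det (frame f) != 0.
Proof.
move=> d0 rd aw.
set T := rows_in AR (tight w); set r := \rank T.
have Tw : T *m w = 0.
  by apply/eqP/rows_in_mul0 => i; rewrite inE => /eqP.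
set X := col_mx (toR alpha) T.
have rX : \rank X = r.+1.
  have : (T < X)%MS.
    rewrite ltmxE -addsmxE addsmxSr /=; apply/negP => h.
    have aX : (toR alpha <= X)%MS by rewrite -addsmxE addsmxSl.
    have /submxP[u e] := submx_trans aX h; move/negP: aw; apply.
    by rewrite /obj e -mulmxA Tw mulmx0 mxE.
  move/rank_ltmx => lt; apply/eqP; rewrite eqn_leq lt andbT -addsmxE.
  apply: leq_trans (mxrank_adds_leqif _ _) _.
  by rewrite -/r -[r.+1]add1n leq_add2r rank_leq_row.
set C := (kermx X^T)^T.
have XC x : X *m x = 0 -> exists z : 'cV_(n.+1), x = C *m z.
  move=> Xx; have : (x^T <= kermx X^T)%MS by rewrite sub_kermx -trmx_mul Xx trmx0.
  by case/submxP => u e; exists u^T; rewrite /C -trmx_mul -e trmxK.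
set G := AR *m C.
have rG : \rank G = (n - r)%N.
  have -> : \rank G = \rank C.
    have /row_fullP[B BA] : row_full AR by apply/eqP.
    apply/eqP; rewrite eqn_leq mxrankM_maxr /=.
    by rewrite -{1}[C]mul1mx -BA -mulmxA mxrankM_maxr.
  by rewrite mxrank_tr mxrank_ker mxrank_tr rX; lia.
have rn : (r <= n)%N by rewrite -ltnS -rX rank_leq_col.
have ltg (j : 'I_n) : (j < n - r)%N -> (j < \rank G)%N by rewrite rG.
have ltT (j : 'I_n) : ~~ (j < n - r)%N -> (j - (n - r) < \rank T)%N.
  by rewrite -/r => ?; have := ltn_ord j; lia.
pose f : {ffun 'I_n -> 'I_m} := [ffun j : 'I_n =>
  match boolP (j < n - r)%N with
  | AltTrue h => maxrankfun G (Ordinal (ltg j h))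
  | AltFalse h => maxrankfun T (Ordinal (ltT j h)) end].
have fG (i : 'I_(\rank G)) : exists j, f j = maxrankfun G i.
  have ij : (i < n)%N by have := ltn_ord i; rewrite {2}rG; lia.
  exists (Ordinal ij); rewrite ffunE; case: {-}_ / boolP => h.
    by congr (maxrankfun G _); apply: val_inj.
  by exfalso; move: (h); rewrite /= -rG ltn_ord.
have fT (i : 'I_(\rank T)) : exists j, f j = maxrankfun T i.
  have ij : (i + (n - r) < n)%N by have := ltn_ord i; rewrite -/r; lia.
  exists (Ordinal ij); rewrite ffunE; case: {-}_ / boolP => h.
    by exfalso; move: (h); rewrite /=; lia.
  by congr (maxrankfun T _); apply: val_inj => /=; rewrite addnK.
have mT (i : 'I_(\rank T)) : maxrankfun T i \in tight w.
  have /row_freeP[B TB] := maxrowsub_free T.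
  apply: contraT => no; have : row i (rowsub (maxrankfun T) T) = 0.
    by rewrite row_rowsub row_rows_in (negPf no).
  move=> /(congr1 (mulmx^~ B)); rewrite -row_mul TB mul0mx => /rowP/(_ i).
  by rewrite !mxE eqxx => /eqP; rewrite oner_eq0.
exists f.
  move=> j dj; rewrite ffunE; case: {-}_ / boolP => h //.
  by exfalso; move: rd h dj; rewrite /rows_rank -/T -/r; lia.
rewrite -(intr_eq0 R) -det_toR -unitfE -unitmxE -row_full_unit.
rewrite /row_full; apply: contraT.
rewrite neq_ltn => /orP[lt|]; last by rewrite ltnNge rank_leq_col.
have [x x0] := ker_exists lt.
rewrite frame_mul => e0.
have ax : toR alpha *m x = 0.
  have := congr1 (@usubmx _ 1 n 1) e0; rewrite col_mxKu => ->.
  by apply/matrixP => i j; rewrite !mxE.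
have fx : rowsub f (AR *m x) = 0.
  have := congr1 (@dsubmx _ 1 n 1) e0; rewrite col_mxKd => ->.
  by apply/matrixP => i j; rewrite !mxE.
have lfx j : rowval (f j) x = 0.
  by have /colP/(_ j) := fx; rewrite mxE [RHS]mxE.
have Xx : X *m x = 0.
  rewrite mul_col_mx ax; suff -> : T *m x = 0 by rewrite col_mx0.
  have /submxP[U ->] : (T <= rowsub (maxrankfun T) T)%MS by rewrite eq_maxrowsub.
  rewrite -mulmxA; suff -> : rowsub (maxrankfun T) T *m x = 0 by rewrite mulmx0.
  apply/row_matrixP => i; rewrite row_mul row_rowsub row_rows_in mT row_mul_rowval row0.
  by have [j <-] := fT i; rewrite lfx raddf0.
have [z xz] := XC x Xx.
have Gz : G *m z = 0.
  have /submxP[U ->] : (G <= rowsub (maxrankfun G) G)%MS by rewrite eq_maxrowsub.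
  rewrite -mulmxA; suff -> : rowsub (maxrankfun G) G *m z = 0 by rewrite mulmx0.
  apply/row_matrixP => i; rewrite row_mul row_rowsub /G row_mul -mulmxA -xz row_mul_rowval row0.
  by have [j <-] := fG i; rewrite lfx raddf0.
move/negP: x0; case; apply/eqP/(rowval_inj rankA) => i.
by rewrite rowvalE xz mulmxA -/G Gz mxE.
Qed.

Lemma select_max_frame d (w : 'cV[R]_n.+1) :
  (0 < d)%N -> (n.+1 <= d + rows_rank AR (tight w))%N -> obj w != 0 ->
  exists f : {ffun 'I_n -> 'I_m}, [/\ forall j : 'I_n, (d.-1 <= j)%N -> f j \in tight w, \det (frame f) != 0 &
   forall f' : {ffun 'I_n -> 'I_m}, (forall j : 'I_n, (d.-1 <= j)%N -> f' j \in tight w) ->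
     (`|\det (frame f')| <= `|\det (frame f)|)%N].
Proof.
move=> d0 rd aw; have [f0 f0t f0d] := select_rows d0 rd aw.
pose P (f : {ffun 'I_n -> 'I_m}) := [forall j : 'I_n, (d.-1 <= j)%N ==> (f j \in tight w)].
have P0 : P f0 by apply/forallP => j; apply/implyP; apply: f0t.
case: (@arg_maxnP _ f0 P (fun f => `|\det (frame f)|%N) P0) => f Pf fmax.
exists f; split.
- by move=> j dj; have /forallP/(_ j)/implyP/(_ dj) := Pf.
- by rewrite -absz_gt0 (leq_trans _ (fmax f0 P0)) // absz_gt0.
- by move=> f' f't; apply: fmax; apply/forallP => j; apply/implyP; apply: f't.
Qed.

Variable f : {ffun 'I_n -> 'I_m}.
Hypothesis detf : \det (frame f) != 0.

Definition coords (i : 'I_m) : 'rV[R]_n.+1 := row i AR *m invmx (toR (frame f)).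
(** The frame of f' in the coordinates of the frame of f. If the two differ in one or two rows, its
    determinant is an entry or a 2 x 2 minor of the new coordinates, and maximality bounds it by
    1. *)
Definition transition (f' : {ffun 'I_n -> 'I_m}) : 'M[R]_(n.+1) :=
  toR (frame f') *m invmx (toR (frame f)).

Lemma frame_unit : toR (frame f) \in unitmx.
Proof. by rewrite unitmxE unitfE det_toR intr_eq0. Qed.

Lemma rowval_coords i x : rowval i x = (coords i *m (toR (frame f) *m x)) 0 0.
Proof.
rewrite /coords mulmxA mulmxKV ?frame_unit // row_mul_rowval.
by rewrite mxE eqxx mulr1n.
Qed.

Lemma det_transition f' : (`|\det (frame f')| <= `|\det (frame f)|)%N ->
  `|\det (transition f')| <= 1.
Proof.
move=> le; rewrite det_mulmx det_inv !det_toR normrM normfV.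
rewrite ler_pdivrMr ?normr_gt0 ?intr_eq0 // mul1r -!intr_norm ler_int.
by rewrite -!abszE lez_nat.
Qed.

Lemma transitionE f' (j : 'I_n) k : transition f' (rshift 1 j) k = coords (f' j) 0 k.
Proof.
have -> : coords (f' j) = row (rshift 1 j) (transition f'); last by rewrite [RHS]mxE.
rewrite /transition row_mul; congr (_ *m _).
by apply/rowP => l; rewrite 2![RHS]mxE frameEd 2![LHS]mxE.
Qed.

Lemma transition_id (f' : {ffun 'I_n -> 'I_m}) (i k : 'I_n.+1) :
  (forall j : 'I_n, i = rshift 1 j -> f' j = f j) -> transition f' i k = (i == k)%:R.
Proof.
move=> same.
suff e : row i (transition f') = row i 1%:M.
  by have /rowP/(_ k) := e; rewrite mxE [RHS]mxE [RHS]mxE.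
rewrite /transition -(mulmxV frame_unit) !row_mul; congr (_ *m _).
apply/rowP => l; rewrite 2![LHS]mxE 2![RHS]mxE; congr (_ %:~R).
case: (@splitP 1 n i) => j ij.
  have -> : i = lshift n (ord0 : 'I_1) by apply: val_inj; rewrite /= ij ord1.
  by rewrite !frameEu.
have iE : i = rshift 1 j by apply: val_inj.
by rewrite iE !frameEd same.
Qed.

End Frame.

(** * Determinants and sums supported on the first indices *)

Lemma det_lower_id (K : comNzRingType) p q (G : 'M[K]_(p + q)) :
  (forall i, row (rshift p i) G = row (rshift p i) 1%:M) -> \det G = \det (ulsubmx G).
Proof.
move=> h; rewrite -[G in LHS]submxK.
have e i j : G (rshift p i) j = (1%:M : 'M_(p + q)) (rshift p i) j.
  by have /rowP/(_ j) := h i; rewrite mxE [RHS]mxE.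
have -> : dlsubmx G = 0.
  by apply/matrixP => i j; rewrite mxE mxE e !mxE eq_rlshift.
have -> : drsubmx G = 1%:M.
  by apply/matrixP => i j; rewrite mxE mxE e !mxE eq_rshift.
by rewrite det_ublock det1 mulr1.
Qed.

Lemma det_upper_id (K : comNzRingType) q (G : 'M[K]_(1 + q)) :
  row (lshift q ord0) G = row (lshift q ord0) 1%:M -> \det G = \det (drsubmx G).
Proof.
move=> h; rewrite -[G in LHS]submxK.
have e j : G (lshift q ord0) j = (1%:M : 'M_(1 + q)) (lshift q ord0) j.
  by have /rowP/(_ j) := h; rewrite mxE [RHS]mxE.
have -> : ursubmx G = 0.
  by apply/matrixP => i j; rewrite ord1 mxE mxE e !mxE eq_lrshift.
have -> : ulsubmx G = 1%:M.
  by apply/matrixP => i j; rewrite !ord1 mxE mxE e !mxE eqxx.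
by rewrite det_lblock det1 mul1r.
Qed.

Lemma det_mx2 (K : comNzRingType) (G : 'M[K]_2) : \det G = G 0 0 * G 1 1 - G 0 1 * G 1 0.
Proof.
rewrite (expand_det_row _ 0) !big_ord_recl big_ord0 addr0 /cofactor !det_mx11 !mxE /=.
rewrite /bump /= expr0 expr1 mul1r mulN1r mulrN.
congr (_ * G _ _ - G _ _ * G _ _); apply: val_inj => //=.
Qed.


Lemma det_id_but1 (K : comNzRingType) k (G : 'M[K]_k.+2) (o1 : 'I_k.+2) : o1 = 1%N :> nat ->
  (forall i j, i != o1 -> G i j = (i == j)%:R) -> \det G = G o1 o1.
Proof.
move=> e1 h; rewrite (@det_lower_id _ 2 k G); last first.
  move=> i; apply/rowP => j; rewrite mxE [RHS]mxE [RHS]mxE h //.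
  by apply/eqP => /(congr1 val) /=; rewrite e1.
rewrite (@det_upper_id _ 1 (@ulsubmx _ 2 k 2 k G)); last first.
  apply/rowP => j; rewrite mxE [RHS]mxE [RHS]mxE mxE mxE h ?eq_lshift //.
  by apply/eqP => /(congr1 val) /=; rewrite e1.
by rewrite det_mx11 !mxE; congr (G _ _); apply: val_inj.
Qed.

Lemma det_id_but2 (K : comNzRingType) k (G : 'M[K]_k.+3) (o1 o2 : 'I_k.+3) :
  o1 = 1%N :> nat -> o2 = 2%N :> nat ->
  (forall i j, i != o1 -> i != o2 -> G i j = (i == j)%:R) ->
  \det G = G o1 o1 * G o2 o2 - G o1 o2 * G o2 o1.
Proof.
move=> e1 e2 h; rewrite (@det_lower_id _ 3 k G); last first.
  move=> i; apply/rowP => j; rewrite mxE [RHS]mxE [RHS]mxE h //.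
    by apply/eqP => /(congr1 val) /=; rewrite e1.
  by apply/eqP => /(congr1 val) /=; rewrite e2.
rewrite (@det_upper_id _ 2 (@ulsubmx _ 3 k 3 k G)); last first.
  apply/rowP => j; rewrite mxE [RHS]mxE [RHS]mxE mxE mxE h ?eq_lshift //.
    by apply/eqP => /(congr1 val) /=; rewrite e1.
  by apply/eqP => /(congr1 val) /=; rewrite e2.
by rewrite det_mx2 !mxE; congr (G _ _ * G _ _ - G _ _ * G _ _); apply: val_inj.
Qed.

Lemma sum_ord2 (K : nmodType) k (F : 'I_k.+2 -> K) (o1 : 'I_k.+2) : o1 = 1%N :> nat ->
  (forall j : 'I_k.+2, (1 < j)%N -> F j = 0) -> \sum_j F j = F ord0 + F o1.
Proof.
move=> e1 h; rewrite !big_ord_recl big1 ?addr0; last by move=> i _; apply: h.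
by congr (_ + F _); apply: val_inj.
Qed.

Lemma sum_ord3 (K : nmodType) k (F : 'I_k.+3 -> K) (o1 o2 : 'I_k.+3) :
  o1 = 1%N :> nat -> o2 = 2%N :> nat ->
  (forall j : 'I_k.+3, (2 < j)%N -> F j = 0) -> \sum_j F j = F ord0 + (F o1 + F o2).
Proof.
move=> e1 e2 h; rewrite !big_ord_recl big1 ?addr0; last by move=> i _; apply: h.
by congr (_ + (F _ + F _)); apply: val_inj.
Qed.

Section Blocks.
Variable R : realType.
Local Notation toR := (map_mx (fun a : int => a%:~R : R)).

Section Common.
Variables (m n : nat) (A : 'M[int]_(m, n.+1)) (alpha : 'rV[int]_n.+1).
Local Notation AR := (toR A).

Definition no_point (y : 'cV[R]_n.+1) := forall p : 'cV[int]_n.+1,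
  (forall i, -1 < rowval AR i (toR p) < rowval AR i y + 1) -> p = 0.

Definition det_bound (N : nat) := forall f, (`|\det (frame A alpha f)| <= N)%N.

(** The disjointness of the translates: a lattice vector joining two of them stays within 1, row by
    row, of some tau w, and tau w lies between 0 and y. *)
Lemma no_point_near y w (p : 'cV[int]_n.+1) (tau : R) : no_point y ->
  in_cone AR w -> in_cone AR (y - w) -> 0 <= tau <= 1 ->
  (forall i, `|rowval AR i (toR p) - tau * rowval AR i w| < 1) -> p = 0.
Proof.
move=> np Cw Cyw /andP[t0 t1] near; apply: np => i.
have := near i; rewrite ltr_norml => /andP[h1 h2].
have w0 := Cw i; have := Cyw i; rewrite rowvalB subr_ge0 => wy.
have tw0 : 0 <= tau * rowval AR i w by rewrite mulr_ge0.
have tw1 : tau * rowval AR i w <= rowval AR i w by rewrite ler_piMl.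
by apply/andP; split; lra.
Qed.
End Common.

(* The [D + 1] points (t, nearest integer to t w1 / W), t <= D, cannot be distinct
   modulo a lattice of index [D]. *)
Lemma block2 m k (A : 'M[int]_(m, k.+2)) (alpha : 'rV[int]_k.+2) y w (N : nat) :
  \rank (toR A) = k.+2 -> no_point A y -> det_bound A alpha N -> (0 < N)%N ->
  in_cone (toR A) w -> in_cone (toR A) (y - w) ->
  (k.+2 <= 2 + rows_rank (toR A) (tight (toR A) w))%N ->
  obj alpha w < N%:R.
Proof.
move=> rA np bN N0 Cw Cyw rw; rewrite ltNge; apply/negP => WN.
set W := obj alpha w in WN.
have W0 : 0 < W by apply: lt_le_trans WN; rewrite ltr0n.
have [f [ft fd fmax]] := select_max_frame rA (isT : (0 < 2)%N) rw (lt0r_neq0 W0).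
pose o1 : 'I_k.+2 := rshift 1 (ord0 : 'I_k.+1).
pose c i := coords R A alpha f i 0.
have s1 i : `|c i o1| <= 1.
  pose f' : {ffun 'I_k.+1 -> 'I_m} := [ffun j : 'I_k.+1 => if j == ord0 then i else f j].
  have f't (j : 'I_k.+1) : (2.-1 <= j)%N -> f' j \in tight (toR A) w.
    move=> j1; rewrite ffunE; case: eqP => [je|_]; last exact: ft.
    by rewrite je in j1.
  have := det_transition R fd (fmax f' f't).
  rewrite (@det_id_but1 _ k _ o1) // => [|a b ao1].
    by rewrite transitionE ffunE eqxx.
  apply: transition_id => // j aj; rewrite ffunE ifN //.
  by apply: contra ao1 => /eqP j0; rewrite aj j0.
have E i (x : 'cV[R]_k.+2) : (forall j : 'I_k.+1, (0 < j)%N -> rowval (toR A) (f j) x = 0) ->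
    rowval (toR A) i x = c i ord0 * obj alpha x + c i o1 * rowval (toR A) (f ord0) x.
  move=> h; rewrite (rowval_coords fd) mxE (@sum_ord2 _ _ _ o1) //; last first.
    move=> j j1; have jj : (j.-1 < k.+1)%N by have := ltn_ord j; lia.
    have -> : j = rshift 1 (Ordinal jj) by apply: val_inj => /=; lia.
    by rewrite frame_mulEd h ?mulr0 //=; lia.
  by rewrite frame_mulEu frame_mulEd.
pose D := `|\det (frame A alpha f)|%N.
have DW : D%:R <= W by apply: le_trans WN; rewrite ler_nat; exact: bN.
set w1 := rowval (toR A) (f ord0) w.
(* Rounding errors lie in a half-open interval of length 1, so two of them differ by strictly less
   than 1. *)
pose kap (t : nat) : int := Num.floor (t%:R / W * w1 + 2^-1).
have kapP t : - 2^-1 < (kap t)%:~R - t%:R / W * w1 <= 2^-1.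
  have /andP[] := floor_itv (t%:R / W * w1 + 2^-1); rewrite -/(kap t) intrD.
  by move=> h1 h2; apply/andP; split; lra.
pose v (t : nat) : 'cV[int]_k.+2 := \col_i (if i == ord0 then t%:Z else if i == o1 then kap t else 0).
have o10 : (o1 == ord0) = false by [].
have vinj : injective v.
  by move=> t t' /colP/(_ ord0); rewrite !mxE eqxx => -[].
have key t t' p : (t' <= t)%N -> (t <= D)%N -> v t - v t' = frame A alpha f *m p -> p = 0.
  move=> t't tD e.
  have eR : toR (frame A alpha f) *m toR p = toR (v t - v t') by rewrite e map_mxM.
  have fp j : rowval (toR A) (f j) (toR p) = ((v t - v t') (rshift 1 j) 0)%:~R.
    by rewrite -(frame_mulEd A alpha) eR mxE.
  have ap : obj alpha (toR p) = t%:R - t'%:R.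
    by rewrite -(frame_mulEu A alpha f) eR !mxE eqxx intrB.
  apply: (@no_point_near _ _ A y w p ((t%:R - t'%:R) / W)) => //.
    apply/andP; split; first by rewrite divr_ge0 ?(ltW W0) // subr_ge0 ler_nat.
    rewrite ler_pdivrMr // mul1r lerBlDr; apply: le_trans (_ : D%:R <= _).
      by rewrite ler_nat.
    by rewrite (le_trans DW) // lerDl ler0n.
  move=> i; rewrite (E i w); last by move=> j j0; apply/eqP; have := ft j j0; rewrite inE.
  rewrite (E i (toR p)); last first.
    move=> j j0; rewrite fp !mxE ifN ?ifN ?subrr //;
      by apply/eqP => /(congr1 val) /=; lia.
  rewrite ap fp !mxE o10 eqxx intrB -/W -/w1.
  have -> : c i ord0 * (t%:R - t'%:R) + c i o1 * ((kap t)%:~R - (kap t')%:~R) -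
    (t%:R - t'%:R) / W * (c i ord0 * W + c i o1 * w1) =
    c i o1 * (((kap t)%:~R - t%:R / W * w1) - ((kap t')%:~R - t'%:R / W * w1)).
    by field; rewrite gt_eqF.
  rewrite normrM; apply: le_lt_trans (_ : `|(kap t)%:~R - t%:R / W * w1 -
      ((kap t')%:~R - t'%:R / W * w1)| < 1).
    by rewrite ler_piMl.
  have /andP[h1 h2] := kapP t; have /andP[h3 h4] := kapP t'.
  by rewrite ltr_norml; apply/andP; split; lra.
have us : uniq [seq v t | t <- iota 0 D.+1] by rewrite map_inj_uniq ?iota_uniq.
have [] := lattice_pigeonhole fd us; first by rewrite size_map size_iota.
move=> _ [_ [/mapP[t tD ->] /mapP[t' t'D ->] /eqP vv [p e]]].
move: tD t'D; rewrite !mem_iota !add0n !ltnS /= => tD t'D.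
have [le|lt] := leqP t' t.
  by apply: vv; apply/eqP; rewrite -subr_eq0 e (key _ _ _ le tD e) mulmx0.
have e' : v t' - v t = frame A alpha f *m (- p) by rewrite mulmxN -e opprB.
apply: vv; apply/eqP; rewrite eq_sym -subr_eq0.
by rewrite e' (key _ _ _ (ltnW lt) t'D e') mulmx0.
Qed.

End Blocks.

Lemma prod_ord3 (K : comNzRingType) k (F : 'I_k.+3 -> K) (o1 o2 : 'I_k.+3) :
  o1 = 1%N :> nat -> o2 = 2%N :> nat ->
  (forall j : 'I_k.+3, (2 < j)%N -> F j = 1) -> \prod_j F j = F ord0 * (F o1 * F o2).
Proof.
move=> e1 e2 h; rewrite !big_ord_recl big1 ?mulr1; last by move=> i _; apply: h.
by congr (_ * (F _ * F _)); apply: val_inj.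
Qed.

Section Block3.
Variable R : realType.
Local Notation toR := (map_mx (fun a : int => a%:~R : R)).

(** By integrality 3 (T + 1) - 4 D is at least 1, so the quadratic terms leave Q^2 / 4 = 100 (T +
    1)^2, more than the loss (T + 1)(3 Q + 2), which is at most 62 (T + 1)^2. Hence the factor
    20. *)
Lemma grid_large (T D : nat) (S : R) : (4 * D < 3 * T.+1)%N ->
  let Q := (20 * T.+1)%N in
  T.+1%:R * (3 / 4 * Q%:R ^+ 2 - 3 * Q%:R - 2) <= S -> (Q ^ 2 * D)%:R < S.
Proof.
move=> DT /=; apply: lt_le_trans; rewrite natrM natrX natrM.
have T1 : 1 <= T.+1%:R :> R by rewrite ler1n.
have : D%:R * 4 + 1 <= 3 * T.+1%:R :> R by rewrite -!natrM natr1 ler_nat; lia.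
set t := T.+1%:R in T1 *; set d := D%:R => h; nra.
Qed.

(* As for [block2], but with the nearest integer replaced by the points of a fine grid in a
   translate of the polygon of [grid_points_in_polygon], whose area is at least 3 / 4. *)
Lemma block3 m k (A : 'M[int]_(m, k.+3)) (alpha : 'rV[int]_k.+3) y w (N : nat) :
  \rank (toR A) = k.+3 -> no_point A y -> det_bound A alpha N -> (0 < N)%N ->
  in_cone (toR A) w -> in_cone (toR A) (y - w) ->
  (k.+3 <= 3 + rows_rank (toR A) (tight (toR A) w))%N ->
  obj alpha w < 4 / 3 * N%:R.
Proof.
move=> rA np bN N0 Cw Cyw rw; rewrite ltNge; apply/negP => WN.
set W := obj alpha w in WN.
have W0 : 0 < W by apply: lt_le_trans WN; rewrite mulr_gt0 ?ltr0n // divr_gt0.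
have [f [ft fd fmax]] := select_max_frame rA (isT : (0 < 3)%N) rw (lt0r_neq0 W0).
pose j1 : 'I_k.+2 := lift ord0 (ord0 : 'I_k.+1).
pose o1 : 'I_k.+3 := rshift 1 (ord0 : 'I_k.+2).
pose o2 : 'I_k.+3 := rshift 1 j1.
pose c i := coords R A alpha f i 0.
have cf j b : c (f j) b = (rshift 1 j == b)%:R.
  by rewrite -(@transition_id R _ _ _ _ _ fd f) // transitionE.
have dets i i' : `|c i o1 * c i' o2 - c i o2 * c i' o1| <= 1.
  pose f' : {ffun 'I_k.+2 -> 'I_m} :=
    [ffun j : 'I_k.+2 => if j == ord0 then i else if j == j1 then i' else f j].
  have f't (j : 'I_k.+2) : (3.-1 <= j)%N -> f' j \in tight (toR A) w.
    move=> j2; rewrite ffunE; case: eqP => [je|_]; first by rewrite je in j2.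
    by case: eqP => [je|_]; [rewrite je in j2 | exact: ft].
  have := det_transition R fd (fmax f' f't).
  rewrite (@det_id_but2 _ k _ o1 o2) // => [|a b ao1 ao2].
    by rewrite !transitionE !ffunE.
  apply: transition_id => // j aj; rewrite ffunE ifN ?ifN //.
    by apply: contra ao2 => /eqP e; rewrite aj e.
  by apply: contra ao1 => /eqP e; rewrite aj e.
(* Rows of the frame have unit vectors as coordinates, so a single coordinate is itself such a
   minor. *)
have unit1 i : `|c i o1| <= 1.
  by have := dets i (f j1); rewrite !cf eqxx mulr1 (_ : _ == o1 = false) // mulr0 subr0.
have unit2 i : `|c i o2| <= 1.
  have := dets (f ord0) i; rewrite !cf eqxx mul1r (_ : _ == o2 = false) // mul0r subr0.
  by [].
have E i (x : 'cV[R]_k.+3) : (forall j : 'I_k.+2, (1 < j)%N -> rowval (toR A) (f j) x = 0) ->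
    rowval (toR A) i x = c i ord0 * obj alpha x +
      (c i o1 * rowval (toR A) (f ord0) x + c i o2 * rowval (toR A) (f j1) x).
  move=> h; rewrite (rowval_coords fd) mxE (@sum_ord3 _ _ _ o1 o2) //; last first.
    move=> j j2; have jj : (j.-1 < k.+2)%N by have := ltn_ord j; lia.
    have -> : j = rshift 1 (Ordinal jj) by apply: val_inj => /=; lia.
    by rewrite frame_mulEd h ?mulr0 //=; lia.
  by rewrite frame_mulEu !frame_mulEd.
pose D := `|\det (frame A alpha f)|%N.
pose T := Num.Def.truncn W.
have TW : T%:R <= W by rewrite truncn_le // ltW.
have WT : W < T.+1%:R by apply: truncnS_gt.
have DT : (4 * D < 3 * T.+1)%N.
  rewrite -(ltr_nat R) !natrM; have : D%:R <= N%:R :> R by rewrite ler_nat; apply: bN.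
  by lra.
pose Q := (20 * T.+1)%N; have Q0 : (0 < Q)%N by [].
have QR : 0 < Q%:R :> R by rewrite ltr0n.
set w1 := rowval (toR A) (f ord0) w; set w2 := rowval (toR A) (f j1) w.
pose rows := [seq (c i o1, c i o2) | i <- enum 'I_m].
have [S SP] : exists S : nat -> seq (int * int), forall t, [/\ uniq (S t),
    forall q, q \in S t -> forall i, `|c i o1 * (q.1%:~R / Q%:R - t%:R / W * w1) +
      c i o2 * (q.2%:~R / Q%:R - t%:R / W * w2)| < 2^-1 &
    3 / 4 * Q%:R ^+ 2 - 3 * Q%:R - 2 <= (size (S t))%:R :> R].
  have : forall t : nat, exists s : seq (int * int), [/\ uniq s,
    forall q, q \in s -> forall i, `|c i o1 * (q.1%:~R / Q%:R - t%:R / W * w1) +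
      c i o2 * (q.2%:~R / Q%:R - t%:R / W * w2)| < 2^-1 &
    3 / 4 * Q%:R ^+ 2 - 3 * Q%:R - 2 <= (size s)%:R :> R].
    have r1 r : r \in rows -> `|r.1| <= 1 /\ `|r.2| <= 1 by case/mapP=> i _ ->; split; [exact: unit1 | exact: unit2].
    have r2 r r' : r \in rows -> r' \in rows -> `|r.1 * r'.2 - r'.1 * r.2| <= 1.
      by move=> /mapP[i _ ->] /mapP[i' _ ->] /=; rewrite [c i' o1 * _]mulrC.
    move=> t; have [s [us sP ss]] := grid_points_in_polygon r1 r2 (t%:R / W * w1) (t%:R / W * w2) Q0.
    exists s; split => // q qs i; apply: (sP q qs (c i o1, c i o2)).
    by apply/mapP; exists i => //; rewrite mem_enum.
  by case/boolp.choice => S SP; exists S.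
pose v (t : nat) (q : int * int) : 'cV[int]_k.+3 := \col_i
  (if i == ord0 then t%:Z else if i == o1 then q.1 else if i == o2 then q.2 else 0).
have vinj t t' q q' : v t q = v t' q' -> t = t' /\ q = q'.
  move=> /colP e; have := e ord0; have := e o1; have := e o2; rewrite !mxE /= => e2 e1 [e0].
  by split => //; rewrite [q]surjective_pairing [q']surjective_pairing; congr pair.
(* Scaling the two coordinates that carry the grid makes the grid integral and multiplies the index
   by Q^2. *)
pose M : 'M[int]_k.+3 :=
  diag_mx (\row_i (if (i == o1) || (i == o2) then Q%:Z else 1)) *m frame A alpha f.
have detM : \det M = Q%:Z ^+ 2 * \det (frame A alpha f).
  rewrite /M det_mulmx det_diag (@prod_ord3 _ _ _ o1 o2) ?mxE //=; first by rewrite mul1r.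
  by move=> j j2; rewrite mxE ifN //; apply/negP => /orP[] /eqP e; rewrite e in j2.
have key t t' q q' p : (t' <= t)%N -> (t <= T)%N -> q \in S t -> q' \in S t' ->
    v t q - v t' q' = M *m p -> p = 0.
  move=> t't tT qS q'S e.
  have fp (i : 'I_k.+3) : (toR (frame A alpha f) *m toR p) i 0 =
      ((v t q - v t' q') i 0)%:~R / (if (i == o1) || (i == o2) then Q%:R else 1).
    have -> : toR (frame A alpha f) *m toR p = toR (frame A alpha f *m p) by rewrite map_mxM.
    rewrite [LHS]mxE e /M -mulmxA mul_diag_mx; set Fp := _ *m p.
    rewrite [in RHS]mxE [X in (X * _)%:~R]mxE intrM.
    case: ifP => _; last by rewrite mul1r divr1.
    by rewrite -[(Posz Q)%:~R]/(Q%:R) mulrAC divff ?mul1r // gt_eqF.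
  have ap : obj alpha (toR p) = t%:R - t'%:R.
    by rewrite -(frame_mulEu A alpha f) fp !mxE /= intrB divr1.
  have p1 : rowval (toR A) (f ord0) (toR p) = q.1%:~R / Q%:R - q'.1%:~R / Q%:R.
    by rewrite -(frame_mulEd A alpha) fp !mxE /= intrB mulrBl.
  have p2 : rowval (toR A) (f j1) (toR p) = q.2%:~R / Q%:R - q'.2%:~R / Q%:R.
    by rewrite -(frame_mulEd A alpha) fp !mxE /= intrB mulrBl.
  apply: (@no_point_near _ _ _ A y w p ((t%:R - t'%:R) / W)) => //.
    apply/andP; split; first by rewrite divr_ge0 ?(ltW W0) // subr_ge0 ler_nat.
    rewrite ler_pdivrMr // mul1r lerBlDr; apply: le_trans (_ : T%:R <= _).
      by rewrite ler_nat.
    by rewrite (le_trans TW) // lerDl ler0n.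
  move=> i; rewrite (E i w); last by move=> j j2; apply/eqP; have := ft j j2; rewrite inE.
  rewrite (E i (toR p)); last first.
    move=> j j2; rewrite -(frame_mulEd A alpha) fp !mxE.
    have e1 : (rshift 1 j == o1) = false by apply/negP => /eqP/(congr1 val) /=; lia.
    have e2 : (rshift 1 j == o2) = false.
      apply/negP => /eqP/(congr1 val) h0; have {}h0 : (1 + j)%N = 2%N := h0.
      by clear -j2 h0; lia.
    by rewrite e1 e2 /= subrr mul0r.
  rewrite ap p1 p2 -/W -/w1 -/w2.
  have [_ /(_ q qS i) h1 _] := SP t; have [_ /(_ q' q'S i) h2 _] := SP t'.
  move: h1 h2; set a := (_ + _ : R); set b := (_ + _ : R) => h1 h2.
  set g := (X in `|X|); have -> : g = a - b by rewrite /g /a /b; field; rewrite !gt_eqF.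
  by apply: le_lt_trans (ler_normB _ _) _; lra.
pose s := [seq v t q | t <- iota 0 T.+1, q <- S t].
have us : uniq s.
  apply: allpairs_uniq_dep; first exact: iota_uniq.
    by move=> t _; case: (SP t).
  by move=> [t q] [t' q'] _ _ /= /vinj[-> ->].
have ss : (`|\det M| < size s)%N.
  rewrite detM abszM abszX absz_nat -/D -(ltr_nat R); apply: (@grid_large T D) => //.
  rewrite size_allpairs_dep sumnE big_map natr_sum.
  have -> : T.+1%:R * (3 / 4 * (20 * T.+1)%:R ^+ 2 - 3 * (20 * T.+1)%:R - 2) =
    \sum_(t <- iota 0 T.+1) (3 / 4 * (20 * T.+1)%:R ^+ 2 - 3 * (20 * T.+1)%:R - 2) :> R.
    by rewrite big_const_seq count_predT size_iota iter_addr_0 mulr_natl.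
  by apply: ler_sum => t _; case: (SP t).
have M0 : \det M != 0 by rewrite detM mulf_neq0 // expf_neq0.
have [_ [_ [/allpairsPdep[t [q [tT qS ->]]] /allpairsPdep[t' [q' [t'T q'S ->]]] /eqP vv [p e]]]] :=
  lattice_pigeonhole M0 us ss.
move: tT t'T; rewrite !mem_iota !add0n !ltnS /= => tT t'T.
have [le|lt] := leqP t' t.
  by apply: vv; apply/eqP; rewrite -subr_eq0 e (key _ _ _ _ _ le tT qS q'S e) mulmx0.
have e' : v t' q' - v t q = M *m (- p) by rewrite mulmxN -e opprB.
apply: vv; apply/eqP; rewrite eq_sym -subr_eq0.
by rewrite e' (key _ _ _ _ _ (ltnW lt) t'T q'S qS e') mulmx0.
Qed.

End Block3.

(** * Proximity *)

Section ConeBound.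
Variable R : realType.
Local Notation toR := (map_mx (fun a : int => a%:~R : R)).
Variables (m n : nat) (A : 'M[int]_(m, n.+2)) (alpha : 'rV[int]_n.+2) (y : 'cV[R]_n.+2).
Variable N : nat.
Hypotheses (rA : \rank (toR A) = n.+2) (np : no_point A y).
Hypotheses (bN : det_bound A alpha N) (N0 : (0 < N)%N).
Local Notation inC := (in_cone (toR A)).
Local Notation rkt w := (rows_rank (toR A) (tight (toR A) w)).

Lemma in_coneD u v : inC u -> inC v -> inC (u + v).
Proof. by move=> Cu Cv i; rewrite rowvalD addr_ge0. Qed.

Lemma objD u v : obj alpha (u + v) = obj alpha u + obj alpha v :> R.
Proof. by rewrite /obj mulmxDr mxE. Qed.

Lemma face3_bound w : inC w -> inC (y - w) -> (n.+2 <= 3 + rkt w)%N ->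
  obj alpha w < 4 / 3 * N%:R.
Proof.
move: (n) A alpha y rA np bN w => [|k] A' a' y' rA' np' bN' w Cw Cyw rw.
  apply: lt_le_trans (block2 rA' np' bN' N0 Cw Cyw _) _; first by rewrite leq_addr.
  by rewrite ler_peMl ?ler0n //; lra.
exact: (block3 rA' np' bN' N0 Cw Cyw rw).
Qed.

(** The constant is dictated by d = 4, 7, 10, ...: two pieces of dimension 2 cost 2 = 18 / 9, and
    each further piece of dimension 3 adds 12 / 9. Splitting 4 as 3 + 1 would not do, so threes are
    removed only from d = 5 on. *)
Lemma face_bound d w : (2 <= d)%N -> inC w -> inC (y - w) -> (n.+2 <= d + rkt w)%N ->
  obj alpha w < (4 * d + 2)%:R / 9 * N%:R.
Proof.
have NR : 0 < N%:R :> R by rewrite ltr0n.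
have [e] := ubnP d; elim: e d w => // e IH d w de d2 Cw Cyw rw.
have piece x : inC x -> inC (w - x) -> inC (y - x) /\ inC (y - (w - x)).
  move=> Cx Cwx; have -> : y - x = (y - w) + (w - x) by rewrite addrA subrK.
  have -> : y - (w - x) = (y - w) + x by rewrite opprB addrA addrAC.
  by split; apply: in_coneD.
have [d3|d3] := leqP d 2.
  have dE : d = 2%N by lia.
  rewrite dE in rw *; have := block2 rA np bN N0 Cw Cyw rw; lra.
have [d4|d4] := leqP d 3.
  have dE : d = 3%N by lia.
  rewrite dE in rw *; have := face3_bound Cw Cyw rw; lra.
have wE x : obj alpha w = obj alpha x + obj alpha (w - x) :> R.
  by rewrite -objD addrC subrK.
have [d5|d5] := leqP d 4.
  have dE : d = 4%N by lia.
  rewrite dE in rw *.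
  have [x [Cx Cwx rx rwx]] := split_cone rA Cw rw (isT : (2 <= 4)%N).
  have [Cyx Cywx] := piece x Cx Cwx; rewrite (wE x).
  have := block2 rA np bN N0 Cx Cyx rx; have := block2 rA np bN N0 Cwx Cywx rwx.
  by lra.
have [x [Cx Cwx rx rwx]] := split_cone rA Cw rw d3.
have [Cyx Cywx] := piece x Cx Cwx; rewrite (wE x).
have h1 := face3_bound Cx Cyx rx.
have h2 : obj alpha (w - x) < (4 * (d - 3) + 2)%:R / 9 * N%:R.
  by apply: IH => //; clear -de d5; lia.
have -> : (4 * d + 2)%:R = (4 * (d - 3) + 2)%:R + 12 :> R.
  by rewrite -natrD; congr (_%:R); clear -d5; lia.
lra.
Qed.

End ConeBound.

(** Expansion along the first row leaves a minor of A without column k, up to the signs of the rows;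
    a repeated row makes it 0. *)
Lemma delta_frame_bound m n (A : 'M[int]_(m, n.+1)) (s : 'I_m -> int) (e : int) (k : 'I_n.+1) :
  (forall i, `|s i|%N = 1%N) -> `|e|%N = 1%N ->
  det_bound (diag_mx (\row_i s i) *m A) (e *: delta_mx 0 k) (Delta n A).
Proof.
move=> s1 e1 f; set A' := _ *m A.
rewrite (expand_det_row _ ord0) (bigD1 k) //= big1 ?addr0; last first.
  move=> j jk; have -> : ord0 = lshift n (ord0 : 'I_1) by apply: val_inj.
  by rewrite frameEu !mxE (negPf jk) andbF mulr0 mul0r.
have -> : frame A' (e *: delta_mx 0 k) f ord0 k = e.
  have -> : ord0 = lshift n (ord0 : 'I_1) by apply: val_inj.
  by rewrite frameEu !mxE !eqxx mulr1.
rewrite abszM e1 mul1n /cofactor abszM absz_sign mul1n.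
pose g : {ffun 'I_n -> 'I_n.+1} := [ffun j => lift k j].
have -> : row' ord0 (col' k (frame A' (e *: delta_mx 0 k) f)) =
    diag_mx (\row_i s (f i)) *m mxsub f g A.
  apply/matrixP => i j; rewrite mul_diag_mx 2![LHS]mxE.
  have -> : lift ord0 i = rshift 1 i by apply: val_inj.
  by rewrite frameEd /A' mul_diag_mx !mxE ffunE.
rewrite det_mulmx abszM det_diag.
have -> : `|(\prod_i (\row_i0 s (f i0)) ord0 i)%R|%N = 1%N.
  rewrite (big_morph absz abszM (erefl : `|1|%N = 1%N)) big1 // => i _.
  by rewrite mxE s1.
rewrite mul1n; have [inj|ninj] := boolP (injectiveb f).
  have ginj : injectiveb g by apply/injectiveP => a b; rewrite !ffunE => /lift_inj.
  by apply: (bigop.bigmax_sup f) => //; apply: (bigop.bigmax_sup g).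
have /injectivePn[a [b ab fab]] := ninj.
by rewrite (determinant_alternate ab) // => j; rewrite !mxE fab.
Qed.

Lemma exists_min_measure (T : Type) (P : T -> Prop) (mu : T -> nat) :
  (exists z, P z) -> exists2 z, P z & forall w, P w -> (mu z <= mu w)%N.
Proof.
move=> [z0 Pz0]; pose Q k := `[< exists2 z, P z & mu z = k >].
have Q0 : exists k, Q k by exists (mu z0); apply/asboolP; exists z0.
case: (ex_minnP Q0) => k /asboolP[z Pz zk] kmin; exists z => // w Pw.
by rewrite zk; apply: kmin; apply/asboolP; exists w.
Qed.

(** * Optimal integer solutions near a vertex *)

Section Program.
Variables (R : realType) (m n : nat) (A : 'M[int]_(m, n)) (b : 'cV[int]_m) (c : 'cV[rat]_n).
Variable x : 'cV[R]_n.
Local Notation toR := (map_mx (fun a : int => a%:~R : R)).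
Local Notation rowval := (rowval (toR A)).
Hypotheses (vx : lp_vertex A b x) (ox : lp_optimal A b c x).
Let I := [set i : 'I_m | rowval i x == (b i 0)%:~R].

Lemma rowval_int i (p : 'cV[int]_n) : rowval i (toR p) = ((A *m p) i 0)%:~R.
Proof.
have e : toR A *m toR p = toR (A *m p) by rewrite map_mxM.
by rewrite rowvalE e mxE.
Qed.

Lemma objR_D (u v : 'cV[R]_n) : objR c (u + v) = objR c u + objR c v.
Proof. by rewrite /objR -big_split; apply: eq_bigr => j _; rewrite mxE mulrDr. Qed.

Lemma objR_Z a (u : 'cV[R]_n) : objR c (a *: u) = a * objR c u.
Proof. by rewrite /objR mulr_sumr; apply: eq_bigr => j _; rewrite mxE mulrCA. Qed.

Lemma step_size (d : 'cV[R]_n) :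
  exists2 eps, 0 < eps & forall i, i \notin I -> eps * `|rowval i d| <= (b i 0)%:~R - rowval i x.
Proof.
have feas i : rowval i x <= (b i 0)%:~R by case: vx => /(_ i).
have [[i0 i0I]|no] := pselect (exists i, i \notin I); last first.
  by exists 1 => // i iI; case: no; exists i.
pose r i := ((b i 0)%:~R - rowval i x) / (1 + `|rowval i d|).
have [i iI imin] := @exists_min_ratio R _ [pred i | i \notin I] r i0 i0I.
have pos j : 0 < 1 + `|rowval j d| by rewrite ltr_pwDl.
exists (r i).
  by rewrite divr_gt0 // subr_gt0 lt_neqAle feas andbT; move: iI; rewrite /= inE.
move=> j jI; have := imin j jI; rewrite {2}/r ler_pdivlMr //; apply: le_trans.
rewrite ler_wpM2l ?lerDr //.
by rewrite divr_ge0 ?(ltW (pos _)) // subr_ge0.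
Qed.

(** Otherwise x would be the midpoint of two distinct feasible points x + eps d and x - eps d. *)
Lemma vertex_kernel (d : 'cV[R]_n) : (forall i, i \in I -> rowval i d = 0) -> d = 0.
Proof.
move=> Id; have [eps e0 He] := step_size d.
have fe (s : R) : `|s| = 1 -> lp_feasible A b (x + (s * eps) *: d).
  move=> s1 i; rewrite -/(rowval i _) rowvalD rowvalZ.
  have [iI|iI] := boolP (i \in I).
    by rewrite Id // mulr0 addr0; case: vx => /(_ i).
  rewrite -lerBrDl; apply: le_trans (He i iI).
  by apply: le_trans (ler_norm _) _; rewrite !normrM s1 mul1r (gtr0_norm e0).
have f1 := fe 1 (normr1 _); have f2 := fe (-1) (normrN1 _).
have [_ /(_ _ _ f1 f2)] := vx; rewrite mul1r mulN1r scaleNr addrACA subrr addr0 => h.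
have xx : x = 2^-1 *: (x + x) by rewrite -mulr2n -scaler_nat scalerA mulVf ?scale1r // pnatr_eq0.
have /addrI/eqP := h xx.
rewrite -subr_eq0 opprK -mulr2n -scaler_nat scalerA scaler_eq0 mulf_eq0 pnatr_eq0.
by rewrite (gt_eqF e0) /= => /eqP.
Qed.

(** A small step from x in direction -p stays feasible and cannot improve the objective. *)
Lemma improving_direction (p : 'cV[R]_n) : (forall i, i \in I -> 0 <= rowval i p) -> 0 <= objR c p.
Proof.
move=> Ip; have [eps e0 He] := step_size p.
have fe : lp_feasible A b (x + (- eps) *: p).
  move=> i; rewrite -/(rowval i _) rowvalD rowvalZ mulNr.
  have [iI|iI] := boolP (i \in I).
    have xi : rowval i x <= (b i 0)%:~R by case: vx => /(_ i).
    by rewrite lerBlDr (le_trans xi) // lerDl mulr_ge0 ?Ip // ltW.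
  rewrite -lerBrDl; apply: le_trans (He i iI).
  by rewrite -mulNr (le_trans (ler_norm _)) // normrM normrN (gtr0_norm e0).
have [_ /(_ _ fe)] := ox; rewrite objR_D objR_Z gerDl mulNr oppr_le0.
by rewrite pmulr_rge0.
Qed.

Lemma objective_scaled : exists2 q : nat, (0 < q)%N & exists cz : 'I_n -> int,
  forall j, ratr (c j 0) * q%:R = (cz j)%:~R :> R.
Proof.
exists (\prod_(j < n) `|denq (c j 0%R)|)%N.
  by rewrite prodn_gt0 // => j; rewrite absz_gt0 denq_neq0.
exists (fun j => numq (c j 0) * (\prod_(i < n | i != j) `|denq (c i 0%R)|)%N%:Z) => j.
rewrite (bigD1 j) //= natrM mulrA intrM; congr (_ * _).
rewrite -{1}(divq_num_den (c j 0)) fmorph_div /= !ratr_int.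
have -> : (`|denq (c j 0%R)|%N)%:R = (denq (c j 0))%:~R :> R.
  by rewrite -[RHS](congr1 (fun z : int => z%:~R) (absz_denq _)).
by rewrite mulfVK // intr_eq0 denq_neq0.
Qed.

(** Once the denominators of c are cleared, objective values are integers bounded above by the value
    at x, so the gap has a least element. *)
Lemma ip_optimum_exists : (exists z, ip_feasible R A b z) -> exists z, ip_optimal R A b c z.
Proof.
move=> ex; have [q q0 [cz czP]] := objective_scaled.
have qR : 0 < q%:R :> R by rewrite ltr0n.
pose val (z : 'cV[int]_n) : int := \sum_j cz j * z j 0.
have valP z : q%:R * objR c (intvR R z) = (val z)%:~R.
  rewrite /objR mulr_sumr rmorph_sum; apply: eq_bigr => j _ /=.
  by rewrite intrM -czP mxE; ring.
pose M := Num.floor (q%:R * objR c x).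
have valM z : ip_feasible R A b z -> val z <= M.
  move=> fz; rewrite floor_ge_int -valP ler_pM2l //.
  by case: ox => _; apply.
have [z fz zmin] := exists_min_measure (fun z => `|M - val z|%N) ex.
exists z; split => // w fw; rewrite -(ler_pM2l qR) !valP ler_int.
have := zmin w fw; have := valM z fz; have := valM w fw; lia.
Qed.

Lemma closest_optimum : (exists z, ip_feasible R A b z) ->
  exists z : 'cV[int]_n, ip_optimal R A b c z /\
   forall p : 'cV[int]_n, (forall i, rowval i (x - toR z) < 0 -> -1 < - rowval i (toR p)) ->
    (forall i, 0 <= rowval i (x - toR z) -> -1 < rowval i (toR p) < rowval i (x - toR z) + 1) -> p = 0.
Proof.
move=> /ip_optimum_exists ex.
pose slack (z : 'cV[int]_n) : int := \sum_(i in I) (b i 0 - (A *m z) i 0).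
have [z oz zmin] := exists_min_measure (fun z => `|slack z|%N) ex.
exists z; split => // p pneg ppos.
have feas w : ip_feasible R A b w -> forall i, (A *m w) i 0 <= b i 0.
  by move=> fw i; have := fw i; rewrite -/(rowval i _) rowval_int ler_int.
have xfeas i : rowval i x <= (b i 0)%:~R by case: vx => /(_ i).
have [fz zopt] := oz.
have Ipos i : i \in I -> 0 <= rowval i (x - toR z).
  by rewrite inE rowvalB rowval_int => /eqP->; rewrite subr_ge0 ler_int feas.
(* An integer above -1 is nonnegative; hence p cannot decrease the objective, and on the tight rows
   it cannot increase the slack. *)
have Ip i : i \in I -> 0 <= (A *m p) i 0.
  by move=> /Ipos/ppos; rewrite !rowval_int => /andP[h _]; move: h; rewrite -[-1]/((-1)%:~R) ltr_int; lia.
have fzp : ip_feasible R A b (z + p).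
  move=> i; rewrite -/(rowval i _) rowval_int ler_int mulmxDr mxE.
  have [ge|lt] := leP 0 (rowval i (x - toR z)).
    have /andP[_] := ppos i ge; rewrite rowvalB !rowval_int => h.
    have : ((A *m p) i 0 + (A *m z) i 0 < b i 0 + 1).
      by rewrite -(ltr_int R) !intrD; have := xfeas i; lra.
    by rewrite ltzD1 addrC.
  have := pneg i lt; rewrite rowval_int -intrN -[-1]/((-1)%:~R) ltr_int => h.
  by move: h (feas z fz i); set u := (A *m p) i 0; set u' := (A *m z) i 0; lia.
have ozp : ip_optimal R A b c (z + p).
  split => // w fw; apply: le_trans (zopt w fw) _.
  have -> : intvR R (z + p) = intvR R z + toR p by apply/matrixP => i j; rewrite !mxE intrD.
  rewrite objR_D lerDl; apply: improving_direction => i iI.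
  by rewrite rowval_int ler0z Ip.
have slack_ge0 w : ip_optimal R A b c w -> 0 <= slack w.
  by move=> [fw _]; apply: sumr_ge0 => i _; rewrite subr_ge0 feas.
have sE : slack (z + p) = slack z - \sum_(i in I) (A *m p) i 0.
  rewrite /slack -sumrB; apply: eq_bigr => i _.
  by rewrite mulmxDr mxE opprD addrA.
have S0 : \sum_(i in I) (A *m p) i 0 <= 0.
  by have := zmin _ ozp; have := slack_ge0 _ oz; have := slack_ge0 _ ozp; rewrite sE; lia.
have S1 : \sum_(i in I) (A *m p) i 0 = 0.
  by apply/eqP; rewrite eq_le S0 sumr_ge0.
have : toR p = 0.
  apply: vertex_kernel => i iI; rewrite rowval_int.
  move/eqP: S1; rewrite psumr_eq0 // => /allP/(_ i (mem_index_enum i)).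
  by rewrite iI /= => /eqP->.
move=> /matrixP e; apply/matrixP => i j; have := e i j; rewrite !mxE => /eqP.
by rewrite intr_eq0 => /eqP.
Qed.

End Program.

Theorem theorem2 (R : realType) (m n : nat) (A : 'M[int]_(m, n))
  (b : 'cV[int]_m) (c : 'cV[rat]_n) (xstar : 'cV[R]_n) :
  (2 <= n)%N ->
  \rank (mxR R A) = n ->
  lp_vertex A b xstar ->
  lp_optimal A b c xstar ->
  (exists z : 'cV[int]_n, ip_feasible R A b z) ->
  exists zstar : 'cV[int]_n,
    ip_optimal R A b c zstar /\
    norm_inf (xstar - intvR R zstar) <
      ((4 * n + 2)%:R / 9%:R) * (Delta n.-1 A)%:R.
Proof.
case: n A c xstar => [|[|n]] // A c x _ rA vx ox ex.
have [z [oz zmin]] := closest_optimum vx ox ex.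
exists z; split => //; rewrite -/(intvR R z) in zmin.
set y := x - intvR R z in zmin *.
pose toR p q := @map_mx int R (fun a : int => a%:~R : R) p q.
pose s i : int := if 0 <= rowval (mxR R A) i y then 1 else -1.
have s1 i : `|s i|%N = 1%N by rewrite /s; case: ifP.
pose A' := diag_mx (\row_i s i) *m A.
have rowvalE i (v : 'cV[R]_n.+2) : rowval (toR _ _ A') i v = (s i)%:~R * rowval (mxR R A) i v.
  have -> : toR _ _ A' = diag_mx (\row_i (s i)%:~R) *m mxR R A.
    by apply/matrixP => k l; rewrite /A' !mul_diag_mx !mxE intrM.
  by rewrite !rowvalE -mulmxA mul_diag_mx mxE mxE.
have rA' : \rank (toR _ _ A') = n.+2.
  have -> : toR _ _ A' = diag_mx (\row_i (s i)%:~R) *m mxR R A.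
    by apply/matrixP => k l; rewrite /A' !mul_diag_mx !mxE intrM.
  rewrite eqmxMfull // row_full_unit unitmxE det_diag unitfE.
  apply/prodf_neq0 => i _; rewrite mxE intr_eq0 -absz_eq0 s1 //.
have np : no_point A' y.
  move=> p pP; apply: zmin => i hi; have := pP i; rewrite !rowvalE /s.
    by rewrite leNgt hi /= !mulN1r => /andP[].
  by rewrite hi !mul1r.
have Cy : in_cone (toR _ _ A') y.
  move=> i; rewrite rowvalE /s; case: (leP 0 (rowval (mxR R A) i y)) => h; first by rewrite mulr1z mul1r.
  by rewrite mulrN1z mulN1r oppr_ge0 ltW.
have Cyy : in_cone (toR _ _ A') (y - y) by move=> i; rewrite subrr rowval0.
(* For d = n.+2 no row has to be tight, so an invertible frame exists. *)
have N0 : (0 < Delta n.+1 A)%N.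
  have bd := delta_frame_bound A (ord0 : 'I_n.+2) s1 (erefl : `|1|%N = 1%N).
  have w0 : obj (1 *: delta_mx 0 ord0 : 'rV[int]_n.+2) (delta_mx ord0 0) != 0 :> R.
    rewrite /obj mxE (bigD1 ord0) //= big1 ?addr0.
      by rewrite !mxE !eqxx mul1r mulr1 oner_eq0.
    by move=> j j0; rewrite [delta_mx ord0 0 j 0]mxE (negPf j0) mulr0.
  have [f _ fd] := select_rows rA' (isT : (0 < n.+2)%N) (leq_addr _ _) w0.
  by apply: leq_trans (bd f); rewrite absz_gt0.
(* The vector y itself is taken in the whole cone, d = n.+2; the two signs e bound the absolute
   value of its k-th coordinate. *)
have B (e : int) (k : 'I_n.+2) : `|e|%N = 1%N ->
    e%:~R * y k 0 < (4 * n.+2 + 2)%:R / 9 * (Delta n.+1 A)%:R.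
  move=> e1; have := face_bound rA' np (delta_frame_bound A k s1 e1) N0
    (isT : (2 <= n.+2)%N) Cy Cyy (leq_addr _ _).
  rewrite /obj mxE (bigD1 k) //= big1 ?addr0.
    by rewrite !mxE !eqxx mulr1.
  by move=> j jk; rewrite !mxE (negPf jk) andbF mulr0 mul0r.
rewrite /norm_inf; apply: (big_ind (fun v : R => v < _)) => [|u v hu hv|k _].
- by rewrite mulr_gt0 ?divr_gt0 ?ltr0n // addn2.
- by rewrite gt_max hu hv.
- rewrite ltr_norml; have := B 1 k (erefl _); have := B (-1) k (erefl _).
  by rewrite mul1r mulN1r /= => h1 h2; rewrite h2 andbT ltrNl.
Qed.
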